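(* Let $\mathcal{C}$ be a finite tensor category over a field $\Bbbk$ and let $A$ be an algebra in $\mathcal{C}$. Then the functor $$\mathbb{S}_A:=\underline{\mathrm{Hom}}_A(-,A)^*:\mathcal{C}_A\to\mathcal{C}_A$$ is a relative Serre functor of the finite left $\mathcal{C}$-module category $\mathcal{C}_A$.
   Context: $\Bbbk$ is an arbitrary field. A finite abelian category is a $\Bbbk$-linear category equivalent to the category of finite-dimensional right modules over a finite-dimensional $\Bbbk$-algebra; functors are $\Bbbk$-linear. A finite tensor category is a finite abelian category $\mathcal{C}$ with a rigid monoidal structure (assumed strict) with bilinear $\otimes$ and simple unit object $\mathbf{1}$. The left dual $X^*$ comes with $\mathrm{ev}_X:X^*\otimes X\to\mathbf{1}$, $\mathrm{coev}_X:\mathbf{1}\to X\otimes X^*$. The category $\mathcal{C}_A$ of right $A$-modules in $\mathcal{C}$ is a finite left $\mathcal{C}$-module category by $X\triangleright M=X\otimes M$, and its internal Hom functor $\underline{\mathrm{Hom}}_A$ is defined by $\mathrm{Hom}_{\mathcal{C}_A}(X\otimes M,N)\cong\mathrm{Hom}_{\mathcal{C}}(X,\underline{\mathrm{Hom}}_A(M,N))$, with counit $\underline{\mathrm{ev}}_{M,N}:\underline{\mathrm{Hom}}_A(M,N)\otimes M\to N$. For $M\in\mathcal{C}_A$, $\underline{\mathrm{Hom}}_A(M,A)$ is a left $A$-module by the action corresponding under adjunction to $m_A\circ(\mathrm{id}_A\otimes\underline{\mathrm{ev}}_{M,A}):A\otimes\underline{\mathrm{Hom}}_A(M,A)\otimes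 M\to A$ ($m_A$ the multiplication), and hence its left dual is a right $A$-module (for a left $A$-module $L$ with action $\ell$, the action $L^*\otimes A\to L^*$ corresponds to $\mathrm{ev}_L\circ(\mathrm{id}_{L^*}\otimes\ell):L^*\otimes A\otimes L\to\mathbf{1}$). An object $P\in\mathcal{C}_A$ is $\mathcal{C}$-projective if $\underline{\mathrm{Hom}}_A(P,-)$ is exact. A relative Serre functor of $\mathcal{C}_A$ is a right exact endofunctor $\mathbb{S}$ of $\mathcal{C}_A$ such that there is a natural isomorphism $\underline{\mathrm{Hom}}_A(P,M)^*\cong\underline{\mathrm{Hom}}_A(M,\mathbb{S}(P))$ for $M\in\mathcal{C}_A$ and $\mathcal{C}$-projective $P\in\mathcal{C}_A$. *)

(* Defs.v *)
From HB Require Import structures.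
From mathcomp Require Import all_boot all_order all_algebra all_field.
From mathcomp Require Import boolp.

Set Implicit Arguments.
Unset Strict Implicit.
Unset Printing Implicit Defensive.

Import GRing.Theory.
Local Open Scope ring_scope.

Declare Scope cat_scope.
Delimit Scope cat_scope with cat.

Record linearCategory (k : fieldType) := LinearCategory {
  obj :> Type;
  mor : obj -> obj -> lmodType k;
  idm : forall X, mor X X;
  compm : forall X Y Z, mor Y Z -> mor X Y -> mor X Z;
  compA : forall X Y Z W (h : mor Z W) (g : mor Y Z) (f : mor X Y),
    compm h (compm g f) = compm (compm h g) f;
  comp1m : forall X Y (f : mor X Y), compm (idm Y) f = f;
  compm1 : forall X Y (f : mor X Y), compm f (idm X) = f;
  comp_linl : forall X Y Z a (g g' : mor Y Z) (f : mor X Y),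
    compm (a *: g + g') f = a *: compm g f + compm g' f;
  comp_linr : forall X Y Z a (g : mor Y Z) (f f' : mor X Y),
    compm g (a *: f + f') = a *: compm g f + compm g f'
}.
Arguments mor {k l} X Y.
Arguments idm {k l} X.
Arguments compm {k l X Y Z} g f.

Notation "g ∘ f" := (compm g f) (at level 37, left associativity) : cat_scope.
Local Open Scope cat_scope.

Section Category.
Variables (k : fieldType) (C : linearCategory k).
Implicit Types X Y Z W : C.

Definition isIso X Y (f : mor X Y) : Prop :=
  exists g : mor Y X, g ∘ f = idm X /\ f ∘ g = idm Y.

Definition isMono X Y (f : mor X Y) : Prop :=
  forall W (g h : mor W X), f ∘ g = f ∘ h -> g = h.

Definition isZeroObject X : Prop := idm X = 0.

Definition isSimple X : Prop :=
  ~ isZeroObject X /\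
  forall Y (i : mor Y X), isMono i -> isZeroObject Y \/ isIso i.

Definition isKernel X Y K (f : mor X Y) (i : mor K X) : Prop :=
  f ∘ i = 0 /\
  forall W (h : mor W X), f ∘ h = 0 -> exists! u : mor W K, i ∘ u = h.

Definition isCokernel X Y Q (f : mor X Y) (p : mor Y Q) : Prop :=
  p ∘ f = 0 /\
  forall W (h : mor Y W), h ∘ f = 0 -> exists! u : mor Q W, u ∘ p = h.

Lemma reassoc X Y Z (g : mor Y Z) (f : mor X Y) (h : mor X Z) :
  g ∘ f = h -> forall W (x : mor Z W), x ∘ g ∘ f = x ∘ h.
Proof. by move=> <- W x; rewrite compA. Qed.

Lemma reassoc3 X Y Z V (h : mor Z V) (g : mor Y Z) (f : mor X Y) (r : mor X V) :
  h ∘ g ∘ f = r -> forall W (x : mor V W), x ∘ h ∘ g ∘ f = x ∘ r.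
Proof. by move=> <- W x; rewrite !compA. Qed.

Lemma comp0m X Y Z (f : mor X Y) : (0 : mor Y Z) ∘ f = 0.
Proof.
by have := comp_linl (-1) (0 : mor Y Z) 0 f; rewrite scaler0 addr0 scaleN1r addNr.
Qed.

Lemma compm0 X Y Z (f : mor Y Z) : f ∘ (0 : mor X Y) = 0.
Proof.
by have := comp_linr (-1) f (0 : mor X Y) 0; rewrite scaler0 addr0 scaleN1r addNr.
Qed.

Lemma compBl X Y Z (g g' : mor Y Z) (f : mor X Y) :
  (g - g') ∘ f = g ∘ f - g' ∘ f.
Proof. by rewrite addrC -(scaleN1r g') comp_linl scaleN1r addrC. Qed.

Lemma compBr X Y Z (g : mor Y Z) (f f' : mor X Y) :
  g ∘ (f - f') = g ∘ f - g ∘ f'.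
Proof. by rewrite addrC -(scaleN1r f') comp_linr scaleN1r addrC. Qed.

Lemma compm_canr X Y Z (f f' : mor Y Z) (u : mor X Y) (v : mor Y X) :
  u ∘ v = idm Y -> f ∘ u = f' ∘ u -> f = f'.
Proof. by move=> uv e; rewrite -[f]compm1 -[f']compm1 -uv !compA e. Qed.

Lemma compm_canl X Y Z (f f' : mor X Y) (u : mor Y Z) (v : mor Z Y) :
  v ∘ u = idm Y -> u ∘ f = u ∘ f' -> f = f'.
Proof. by move=> vu e; rewrite -[f]comp1m -[f']comp1m -vu -!compA e. Qed.

End Category.

Record functor (k : fieldType) (C D : linearCategory k) := Functor {
  fobj :> C -> D;
  fmap : forall X Y : C, mor X Y -> mor (fobj X) (fobj Y);
  fmap1 : forall X, fmap (idm X) = idm (fobj X);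
  fmapM : forall X Y Z (g : mor Y Z) (f : mor X Y),
    fmap (g ∘ f) = fmap g ∘ fmap f;
  fmap_lin : forall X Y a (f f' : mor X Y),
    fmap (a *: f + f') = a *: fmap f + fmap f'
}.
Arguments fmap {k C D} f {X Y} : rename.

Section Functors.
Variable k : fieldType.

(* [isKernel f i] says that 0 -> K -> X -> Y is exact and [isCokernel f p] that
   X -> Y -> Q -> 0 is exact; a functor is left (right) exact when it preserves
   such sequences. *)
Definition leftExact (C D : linearCategory k) (F : functor C D) : Prop :=
  forall (X Y K : C) (f : mor X Y) (i : mor K X),
    isKernel f i -> isKernel (fmap F f) (fmap F i).

Definition rightExact (C D : linearCategory k) (F : functor C D) : Prop :=
  forall (X Y Q : C) (f : mor X Y) (p : mor Y Q),
    isCokernel f p -> isCokernel (fmap F f) (fmap F p).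

Definition exactFunctor (C D : linearCategory k) (F : functor C D) : Prop :=
  leftExact F /\ rightExact F.

Definition idFunctor (C : linearCategory k) : functor C C.
Proof. by exists (fun X : C => X) (fun X Y f => f). Defined.

Definition compFunctor (C D E : linearCategory k)
  (G : functor D E) (F : functor C D) : functor C E.
Proof.
exists (fun X => G (F X)) (fun X Y f => fmap G (fmap F f)).
- by move=> X; rewrite !fmap1.
- by move=> X Y Z g f; rewrite !fmapM.
- by move=> X Y a f f'; rewrite !fmap_lin.
Defined.

Definition naturallyIsomorphic (C D : linearCategory k) (F G : functor C D) :=
  exists phi : forall X : C, mor (F X) (G X),
    (forall X, isIso (phi X)) /\
    (forall X Y (f : mor X Y), fmap G f ∘ phi X = phi Y ∘ fmap F f).

Definition equivalent (C D : linearCategory k) : Prop :=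
  exists (F : functor C D) (G : functor D C),
    naturallyIsomorphic (compFunctor G F) (idFunctor C) /\
    naturallyIsomorphic (compFunctor F G) (idFunctor D).

End Functors.

Record fdModule (k : fieldType) (R : falgType k) := FdModule {
  fdm :> vectType k;
  fdact : fdm -> R -> fdm;
  fdact1 : forall v, fdact v 1 = v;
  fdactM : forall v a b, fdact v (a * b) = fdact (fdact v a) b;
  fdact_linl : forall c v w a,
    fdact (c *: v + w) a = c *: fdact v a + fdact w a;
  fdact_linr : forall c v a b,
    fdact v (c *: a + b) = c *: fdact v a + fdact v b
}.

Section FdModules.
Variables (k : fieldType) (R : falgType k).

Definition fdLinear (V W : fdModule R) : {pred 'Hom(V, W)} :=
  fun f => `[< forall v a, f (fdact v a) = fdact (f v) a >].

Record fdHom (V W : fdModule R) := FdHom {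
  fdh : 'Hom(V, W);
  fdhP : fdh \in @fdLinear V W
}.

Lemma fdLinear_submod (V W : fdModule R) : submod_closed (@fdLinear V W).
Proof.
split=> [|c f g /asboolP fP /asboolP gP]; apply/asboolP => v a.
  rewrite !zero_lfunE.
  have := fdact_linl (-1) 0 (0 : W) a.
  by rewrite scaler0 addr0 scaleN1r addNr.
by rewrite !add_lfunE !scale_lfunE fP gP fdact_linl.
Qed.

HB.instance Definition _ (V W : fdModule R) :=
  GRing.isSubmodClosed.Build k 'Hom(V, W) (@fdLinear V W) (fdLinear_submod V W).
HB.instance Definition _ (V W : fdModule R) := [isSub for @fdh V W].
HB.instance Definition _ (V W : fdModule R) := [Choice of fdHom V W by <:].
HB.instance Definition _ (V W : fdModule R) :=
  [SubChoice_isSubLmodule of fdHom V W by <:].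

Lemma fdhE (V W : fdModule R) (f : fdHom V W) v a :
  fdh f (fdact v a) = fdact (fdh f v) a.
Proof. by case: f => f /= /asboolP. Qed.

Definition fdId (V : fdModule R) : fdHom V V.
Proof. by exists \1%VF; apply/asboolP => v a; rewrite !id_lfunE. Defined.

Definition fdComp (V W U : fdModule R) (g : fdHom W U) (f : fdHom V W) :
  fdHom V U.
Proof.
by exists (fdh g \o fdh f)%VF; apply/asboolP => v a; rewrite !comp_lfunE !fdhE.
Defined.

Definition fdCategory : linearCategory k.
Proof.
exists (fdModule R) (fun V W => fdHom V W) fdId fdComp.
- by move=> X Y Z W h g f; apply/val_inj/comp_lfunA.
- by move=> X Y f; apply/val_inj/comp_lfun1l.
- by move=> X Y f; apply/val_inj/comp_lfun1r.
- move=> X Y Z a g g' f; apply: val_inj => /=.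
  by rewrite comp_lfunDl -comp_lfunZl.
- move=> X Y Z a g f f'; apply: val_inj => /=.
  by rewrite comp_lfunDr -comp_lfunZr.
Defined.

End FdModules.

(* [falgType] excludes the zero algebra, hence the zero category; this is
   harmless below, where the category has a nonzero object. *)
Definition finiteAbelian (k : fieldType) (C : linearCategory k) : Prop :=
  exists R : falgType k, equivalent C (fdCategory R).

(* Associators and unitors are kept explicit: equality of objects is not a
   workable notion here.  A strict monoidal category is the instance whose
   structure isomorphisms are the (transported) identities. *)
Record monoidalCategory (k : fieldType) := MonoidalCategory {
  mcat :> linearCategory k;
  tens : mcat -> mcat -> mcat;
  tensm : forall X X' Y Y' : mcat,
    mor X X' -> mor Y Y' -> mor (tens X Y) (tens X' Y');
  unit1 : mcat;
  assoc : forall X Y Z, mor (tens (tens X Y) Z) (tens X (tens Y Z));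
  assocV : forall X Y Z, mor (tens X (tens Y Z)) (tens (tens X Y) Z);
  lunit : forall X, mor (tens unit1 X) X;
  lunitV : forall X, mor X (tens unit1 X);
  runit : forall X, mor (tens X unit1) X;
  runitV : forall X, mor X (tens X unit1);
  tensm1 : forall X Y, tensm (idm X) (idm Y) = idm (tens X Y);
  tensmM : forall X X' X'' Y Y' Y'' (f' : mor X' X'') (f : mor X X')
      (g' : mor Y' Y'') (g : mor Y Y'),
    tensm (f' ∘ f) (g' ∘ g) = tensm f' g' ∘ tensm f g;
  tensm_linl : forall X X' Y Y' a (f f' : mor X X') (g : mor Y Y'),
    tensm (a *: f + f') g = a *: tensm f g + tensm f' g;
  tensm_linr : forall X X' Y Y' a (f : mor X X') (g g' : mor Y Y'),
    tensm f (a *: g + g') = a *: tensm f g + tensm f g';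
  assocK : forall X Y Z, assocV X Y Z ∘ assoc X Y Z = idm _;
  assocVK : forall X Y Z, assoc X Y Z ∘ assocV X Y Z = idm _;
  lunitK : forall X, lunitV X ∘ lunit X = idm _;
  lunitVK : forall X, lunit X ∘ lunitV X = idm _;
  runitK : forall X, runitV X ∘ runit X = idm _;
  runitVK : forall X, runit X ∘ runitV X = idm _;
  assoc_nat : forall X X' Y Y' Z Z' (f : mor X X') (g : mor Y Y') (h : mor Z Z'),
    assoc X' Y' Z' ∘ tensm (tensm f g) h = tensm f (tensm g h) ∘ assoc X Y Z;
  lunit_nat : forall X Y (f : mor X Y),
    lunit Y ∘ tensm (idm unit1) f = f ∘ lunit X;
  runit_nat : forall X Y (f : mor X Y),
    runit Y ∘ tensm f (idm unit1) = f ∘ runit X;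
  pentagon : forall W X Y Z,
    tensm (idm W) (assoc X Y Z) ∘ assoc W (tens X Y) Z ∘
      tensm (assoc W X Y) (idm Z)
    = assoc W X (tens Y Z) ∘ assoc (tens W X) Y Z;
  triangle : forall X Y,
    tensm (idm X) (lunit Y) ∘ assoc X unit1 Y = tensm (runit X) (idm Y)
}.
Arguments tens {k m} X Y.
Arguments tensm {k m X X' Y Y'} f g.
Arguments unit1 {k m}.
Arguments assoc {k m} X Y Z.
Arguments assocV {k m} X Y Z.
Arguments lunit {k m} X.
Arguments lunitV {k m} X.
Arguments runit {k m} X.
Arguments runitV {k m} X.

Notation "X ⊗ Y" := (tens X Y) (at level 33, left associativity) : cat_scope.
Notation "f ⊗^ g" := (tensm f g) (at level 33, left associativity) : cat_scope.
Notation "𝟙" := unit1 (at level 0) : cat_scope.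

Section Duals.
Variables (k : fieldType) (C : monoidalCategory k).

Record leftDual (X : C) := LeftDual {
  ldobj :> C;
  ev : mor (ldobj ⊗ X) 𝟙;
  coev : mor 𝟙 (X ⊗ ldobj);
  ldual_zig :
    runit X ∘ (idm X ⊗^ ev) ∘ assoc X ldobj X ∘ (coev ⊗^ idm X) ∘ lunitV X
    = idm X;
  ldual_zag :
    lunit ldobj ∘ (ev ⊗^ idm ldobj) ∘ assocV ldobj X ldobj ∘
      (idm ldobj ⊗^ coev) ∘ runitV ldobj
    = idm ldobj
}.

Record rightDual (X : C) := RightDual {
  rdobj :> C;
  rdev : mor (X ⊗ rdobj) 𝟙;
  rdcoev : mor 𝟙 (rdobj ⊗ X);
  rdual_zig :
    lunit X ∘ (rdev ⊗^ idm X) ∘ assocV X rdobj X ∘ (idm X ⊗^ rdcoev) ∘ runitV X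
    = idm X;
  rdual_zag :
    runit rdobj ∘ (idm rdobj ⊗^ rdev) ∘ assoc rdobj X rdobj ∘
      (rdcoev ⊗^ idm rdobj) ∘ lunitV rdobj
    = idm rdobj
}.

End Duals.

Record finiteTensorCategory (k : fieldType) := FiniteTensorCategory {
  ftc :> monoidalCategory k;
  ldual : forall X : ftc, leftDual X;
  rdual : forall X : ftc, rightDual X;
  ftc_finite : finiteAbelian ftc;
  ftc_simple : isSimple (unit1 : ftc)
}.
Arguments ldual {k f} X.
Arguments rdual {k f} X.

Section MonoidalTheory.
Variables (k : fieldType) (C : monoidalCategory k).
Implicit Types X Y Z W : C.

Lemma tensmMl X Y Y' Y'' (g' : mor Y' Y'') (g : mor Y Y') :
  idm X ⊗^ (g' ∘ g) = (idm X ⊗^ g') ∘ (idm X ⊗^ g).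
Proof. by rewrite -tensmM comp1m. Qed.

Lemma tensmMr X X' X'' Y (f' : mor X' X'') (f : mor X X') :
  (f' ∘ f) ⊗^ idm Y = (f' ⊗^ idm Y) ∘ (f ⊗^ idm Y).
Proof. by rewrite -tensmM comp1m. Qed.

Lemma tensmC X X' Y Y' (f : mor X X') (g : mor Y Y') :
  (f ⊗^ idm Y') ∘ (idm X ⊗^ g) = (idm X' ⊗^ g) ∘ (f ⊗^ idm Y).
Proof. by rewrite -!tensmM !compm1 !comp1m. Qed.

Lemma tensm_split X X' Y Y' (f : mor X X') (g : mor Y Y') :
  f ⊗^ g = (idm X' ⊗^ g) ∘ (f ⊗^ idm Y).
Proof. by rewrite -!tensmM compm1 comp1m. Qed.

Lemma assocV_nat X X' Y Y' Z Z' (f : mor X X') (g : mor Y Y') (h : mor Z Z') :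
  assocV X' Y' Z' ∘ (f ⊗^ (g ⊗^ h)) = (f ⊗^ g ⊗^ h) ∘ assocV X Y Z.
Proof.
rewrite -[LHS]compm1 -(assocVK X Y Z) !compA (reassoc (esym (assoc_nat f g h))).
by rewrite compA assocK comp1m.
Qed.

Lemma runitV_nat X Y (f : mor X Y) :
  runitV Y ∘ f = (f ⊗^ idm 𝟙) ∘ runitV X.
Proof.
rewrite -[LHS]compm1 -(runitVK X) !compA (reassoc (esym (runit_nat f))).
by rewrite compA runitK comp1m.
Qed.

Lemma lunitV_nat X Y (f : mor X Y) :
  lunitV Y ∘ f = (idm 𝟙 ⊗^ f) ∘ lunitV X.
Proof.
rewrite -[LHS]compm1 -(lunitVK X) !compA (reassoc (esym (lunit_nat f))).
by rewrite compA lunitK comp1m.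
Qed.

Lemma runit_inj X Y (f g : mor X Y) : f ⊗^ idm 𝟙 = g ⊗^ idm 𝟙 -> f = g.
Proof.
move=> e; rewrite -[f]compm1 -[g]compm1 -(runitVK X) !compA.
by rewrite -!runit_nat e.
Qed.

Lemma lunit_inj X Y (f g : mor X Y) : idm 𝟙 ⊗^ f = idm 𝟙 ⊗^ g -> f = g.
Proof.
move=> e; rewrite -[f]compm1 -[g]compm1 -(lunitVK X) !compA.
by rewrite -!lunit_nat e.
Qed.

Lemma lunit_tens X Y : lunit (X ⊗ Y) ∘ assoc 𝟙 X Y = lunit X ⊗^ idm Y.
Proof.
apply: lunit_inj.
apply: (compm_canr (u := assoc _ _ _) (v := assocV _ _ _)).
  exact: assocVK.
apply: (compm_canr (u := assoc 𝟙 𝟙 X ⊗^ idm Y) (v := assocV _ _ _ ⊗^ idm Y)).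
  by rewrite -tensmMr assocVK tensm1.
rewrite tensmMl (reassoc3 (pentagon _ _ _ _)) compA triangle.
rewrite -tensm1 -assoc_nat -triangle tensmMr compA.
by rewrite assoc_nat.
Qed.

Lemma runit_tens X Y : (idm X ⊗^ runit Y) ∘ assoc X Y 𝟙 = runit (X ⊗ Y).
Proof.
apply: runit_inj.
apply: (compm_canl (u := assoc _ _ _) (v := assocV _ _ _)).
  exact: assocK.
rewrite tensmMr compA assoc_nat -triangle tensmMl.
rewrite (reassoc3 (pentagon _ _ _ _)) compA.
by rewrite -assoc_nat tensm1 -compA triangle.
Qed.

Lemma lunit1 : lunit (𝟙 : C) = runit 𝟙.
Proof.
apply: runit_inj; rewrite -lunit_tens -triangle; congr (_ ∘ _).
apply: (compm_canl (u := lunit _) (v := lunitV _)); first exact: lunitK.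
by rewrite lunit_nat.
Qed.

Variables (M : C) (D : leftDual M).

(* (N ⊗ D, evT) is universal among pairs (X, f : X ⊗ M -> N). *)
Definition evT N : mor (N ⊗ D ⊗ M) N :=
  runit N ∘ (idm N ⊗^ ev D) ∘ assoc N D M.

Definition transp X N (f : mor (X ⊗ M) N) : mor X (N ⊗ D) :=
  (f ⊗^ idm D) ∘ assocV X M D ∘ (idm X ⊗^ coev D) ∘ runitV X.

Lemma transpK X N (f : mor (X ⊗ M) N) : evT N ∘ (transp f ⊗^ idm M) = f.
Proof.
rewrite /evT /transp !tensmMr !compA.
rewrite (reassoc (assoc_nat f (idm D) (idm M))) !compA tensm1.
rewrite (reassoc (esym (tensmC f (ev D)))) !compA runit_nat.
have pent : assoc (X ⊗ M) D M ∘ (assocV X M D ⊗^ idm M) =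
  assocV X M (D ⊗ M) ∘ (idm X ⊗^ assoc M D M) ∘ assoc X (M ⊗ D) M.
  apply: (compm_canl (u := assoc _ _ _) (v := assocV _ _ _)).
    exact: assocK.
  rewrite !compA assocVK comp1m -pentagon -(compA _ (_ ⊗^ _) (_ ⊗^ _)) -tensmMr.
  by rewrite assocVK tensm1 compm1.
rewrite (reassoc pent) !compA (reassoc (assoc_nat (idm X) (coev D) (idm M))) !compA.
have e1 : (idm (X ⊗ M) ⊗^ ev D) ∘ assocV X M (D ⊗ M) =
          assocV X M 𝟙 ∘ (idm X ⊗^ (idm M ⊗^ ev D)).
  by rewrite assocV_nat tensm1.
have e2 : runit (X ⊗ M) ∘ assocV X M 𝟙 = idm X ⊗^ runit M.
  by rewrite -runit_tens -compA assocVK compm1.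
rewrite (reassoc e1) !compA (reassoc e2).
rewrite 3!(reassoc (esym (tensmMl _ _ _))).
have zig : runit M ∘ (idm M ⊗^ ev D) ∘ assoc M D M ∘ (coev D ⊗^ idm M) = lunit M.
  by rewrite -[LHS]compm1 -(lunitK M) !compA ldual_zig comp1m.
rewrite !compA zig (reassoc (triangle _ _)) -compA -tensmMr runitVK tensm1.
by rewrite compm1.
Qed.

Lemma transp_evT X N (g : mor X (N ⊗ D)) : transp (evT N ∘ (g ⊗^ idm M)) = g.
Proof.
rewrite /transp tensmMr.
have n1 : (g ⊗^ idm M ⊗^ idm D) ∘ assocV X M D =
    assocV (N ⊗ D) M D ∘ (g ⊗^ idm (M ⊗ D)).
  by rewrite -tensm1 assocV_nat.
rewrite (reassoc n1) !compA (reassoc (tensmC g (coev D))) !compA.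
rewrite (reassoc (esym (runitV_nat g))) !compA -[RHS]comp1m; congr (_ ∘ _).
rewrite /evT !tensmMr.
have pent : assoc N D M ⊗^ idm D ∘ assocV (N ⊗ D) M D =
    assocV N (D ⊗ M) D ∘ (idm N ⊗^ assocV D M D) ∘ assoc N D (M ⊗ D).
  apply: (compm_canl (u := assoc _ _ _) (v := assocV _ _ _)).
    exact: assocK.
  rewrite !compA assocVK comp1m.
  apply: (compm_canl (u := idm N ⊗^ assoc D M D) (v := idm N ⊗^ assocV D M D)).
    by rewrite -tensmMl assocK tensm1.
  rewrite !compA pentagon -tensmMl assocVK tensm1 comp1m -compA assocVK.
  by rewrite compm1.
rewrite (reassoc pent) !compA.
have n2 : idm N ⊗^ ev D ⊗^ idm D ∘ assocV N (D ⊗ M) D =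
    assocV N 𝟙 D ∘ (idm N ⊗^ (ev D ⊗^ idm D)).
  by rewrite assocV_nat.
rewrite (reassoc n2) !compA.
have tri : runit N ⊗^ idm D ∘ assocV N 𝟙 D = idm N ⊗^ lunit D.
  by rewrite -triangle -compA assocVK compm1.
have n3 : assoc N D (M ⊗ D) ∘ (idm (N ⊗ D) ⊗^ coev D) =
    (idm N ⊗^ (idm D ⊗^ coev D)) ∘ assoc N D 𝟙.
  by rewrite -assoc_nat tensm1.
have n4 : assoc N D 𝟙 ∘ runitV (N ⊗ D) = idm N ⊗^ runitV D.
  apply: (compm_canl (u := idm N ⊗^ runit D) (v := idm N ⊗^ runitV D)).
    by rewrite -tensmMl runitK tensm1.
  by rewrite compA runit_tens runitVK -tensmMl runitVK tensm1.
rewrite tri (reassoc n3) compA (reassoc n4).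
by rewrite -!tensmMl ldual_zag tensm1.
Qed.

End MonoidalTheory.
Arguments evT {k C M} D N.
Arguments transp {k C M} D {X N} f.
Arguments transpK {k C M} D {X N} f.
Arguments transp_evT {k C M} D {X N} g.

Record algebraObject (k : fieldType) (C : monoidalCategory k) := AlgebraObject {
  algo :> C;
  amul : mor (algo ⊗ algo) algo;
  aone : mor 𝟙 algo;
  amulA : amul ∘ (amul ⊗^ idm algo) =
          amul ∘ (idm algo ⊗^ amul) ∘ assoc algo algo algo;
  amul1m : amul ∘ (aone ⊗^ idm algo) = lunit algo;
  amulm1 : amul ∘ (idm algo ⊗^ aone) = runit algo
}.
Arguments amul {k C} a.
Arguments aone {k C} a.

Section Modules.
Variables (k : fieldType) (C : monoidalCategory k) (A : algebraObject C).

Record rightModule := RightModule {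
  rmo :> C;
  ract : mor (rmo ⊗ A) rmo;
  ractA : ract ∘ (ract ⊗^ idm A) = ract ∘ (idm rmo ⊗^ amul A) ∘ assoc rmo A A;
  ract1 : ract ∘ (idm rmo ⊗^ aone A) = runit rmo
}.

Record leftModule := LeftModule {
  lmo :> C;
  lmact : mor (A ⊗ lmo) lmo;
  lmactA : lmact ∘ (amul A ⊗^ idm lmo) = lmact ∘ (idm A ⊗^ lmact) ∘ assoc A A lmo;
  lmact1 : lmact ∘ (aone A ⊗^ idm lmo) = lunit lmo
}.

Definition rlinear (M N : rightModule) : {pred mor M N} :=
  fun f => f ∘ ract M == ract N ∘ (f ⊗^ idm A).

Record moduleMor (M N : rightModule) := ModuleMor {
  mmor :> mor M N;
  mmorP : mmor \in @rlinear M N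
}.

Lemma rlinear_submod (M N : rightModule) : submod_closed (@rlinear M N).
Proof.
have tens0m : (0 : mor M N) ⊗^ idm A = 0.
  have := tensm_linl (-1) (0 : mor M N) 0 (idm A).
  by rewrite scaler0 addr0 scaleN1r addNr.
split=> [|c f g /eqP fP /eqP gP]; apply/eqP.
  by rewrite comp0m tens0m compm0.
by rewrite comp_linl tensm_linl comp_linr fP gP.
Qed.

HB.instance Definition _ (M N : rightModule) :=
  GRing.isSubmodClosed.Build k (mor M N) (@rlinear M N) (rlinear_submod M N).
HB.instance Definition _ (M N : rightModule) := [isSub for @mmor M N].
HB.instance Definition _ (M N : rightModule) := [Choice of moduleMor M N by <:].
HB.instance Definition _ (M N : rightModule) :=
  [SubChoice_isSubLmodule of moduleMor M N by <:].

Lemma mmorE (M N : rightModule) (f : moduleMor M N) :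
  f ∘ ract M = ract N ∘ (f ⊗^ idm A).
Proof. by apply/eqP; case: f. Qed.

Definition mmorId (M : rightModule) : moduleMor M M.
Proof.
by exists (idm M); apply/eqP; rewrite tensm1 comp1m compm1.
Defined.

Definition mmorComp (M N K : rightModule) (g : moduleMor N K) (f : moduleMor M N) :
  moduleMor M K.
Proof.
exists (g ∘ f); apply/eqP; rewrite tensmMr -compA mmorE compA mmorE.
by rewrite compA.
Defined.

Definition modCat : linearCategory k.
Proof.
exists rightModule (fun M N => moduleMor M N) mmorId mmorComp.
- by move=> X Y Z W h g f; apply/val_inj/compA.
- by move=> X Y f; apply/val_inj/comp1m.
- by move=> X Y f; apply/val_inj/compm1.
- by move=> X Y Z a g g' f; apply/val_inj/comp_linl.
- by move=> X Y Z a g f f'; apply/val_inj/comp_linr.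
Defined.

Definition mactObj (X : C) (M : modCat) : modCat.
Proof.
exists (X ⊗ M) ((idm X ⊗^ ract M) ∘ assoc X M A).
- rewrite tensmMr !compA (reassoc (assoc_nat (idm X) (ract M) (idm A))) !compA.
  rewrite -tensmMl ractA !tensmMl (reassoc3 (pentagon _ _ _ _)) !compA.
  have n : assoc X M A ∘ (idm (X ⊗ M) ⊗^ amul A) =
           (idm X ⊗^ (idm M ⊗^ amul A)) ∘ assoc X M (A ⊗ A).
    by rewrite -assoc_nat tensm1.
  by rewrite (reassoc n) !compA.
- have n : assoc X M A ∘ (idm (X ⊗ M) ⊗^ aone A) =
           (idm X ⊗^ (idm M ⊗^ aone A)) ∘ assoc X M 𝟙.
    by rewrite -assoc_nat tensm1.
  by rewrite (reassoc n) compA -tensmMl ract1 runit_tens.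
Defined.

Definition mactMor (X Y : C) (M N : modCat) (f : mor X Y) (g : mor M N) :
  mor (mactObj X M) (mactObj Y N).
Proof.
exists (f ⊗^ mmor g); apply/eqP; rewrite /= compA -tensmM compm1 mmorE.
by rewrite -compA assoc_nat compA -tensmM comp1m.
Defined.

End Modules.
Arguments ract {k C A} r.
Arguments lmact {k C A} l.

Notation "X ▷ M" := (mactObj X M) (at level 33, left associativity) : cat_scope.
Notation "f ▷^ g" := (mactMor f g) (at level 33, left associativity) : cat_scope.

Section InternalHom.
Variables (k : fieldType) (C : monoidalCategory k) (A : algebraObject C).

(* The adjunction bijection is given by its counit [iev] and its inverse
   [icurry]; its naturality in X is automatic for such a presentation, and
   naturality in M and N defines the functor ([imap] below). *)
Record internalHom := InternalHom {
  ihom :> modCat A -> modCat A -> C;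
  iev : forall M N : modCat A, mor (ihom M N ▷ M) N;
  icurry : forall (X : C) (M N : modCat A), mor (X ▷ M) N -> mor X (ihom M N);
  icurryK : forall (X : C) (M N : modCat A) (f : mor (X ▷ M) N),
    iev M N ∘ (icurry f ▷^ idm M) = f;
  iev_icurry : forall (X : C) (M N : modCat A) (g : mor X (ihom M N)),
    icurry (iev M N ∘ (g ▷^ idm M)) = g
}.

End InternalHom.

Section Dual.
Variables (k : fieldType) (C : monoidalCategory k).

Lemma dual_ext (M : C) (D : leftDual M) (X : C) (g g' : mor X D) :
  ev D ∘ (g ⊗^ idm M) = ev D ∘ (g' ⊗^ idm M) -> g = g'.
Proof.
move=> e; apply: (compm_canl (u := lunitV D) (v := lunit D)).
  exact: lunitVK.
rewrite -[LHS](transp_evT D) -[RHS](transp_evT D); congr (transp D _).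
suff evE : evT D 𝟙 ∘ (lunitV D ⊗^ idm M) = ev D.
  by rewrite !tensmMr !compA evE.
rewrite /evT -lunit1 lunit_nat.
have -> : lunitV D ⊗^ idm M = assocV 𝟙 D M ∘ lunitV (D ⊗ M).
  apply: (compm_canl (u := lunit D ⊗^ idm M) (v := lunitV D ⊗^ idm M)).
    by rewrite -tensmMr lunitK tensm1.
  rewrite -tensmMr lunitVK tensm1 -lunit_tens compA.
  by rewrite -(compA _ (assoc _ _ _)) assocVK compm1 lunitVK.
by rewrite !compA -(compA _ (assoc _ _ _)) assocVK compm1 -compA lunitVK compm1.
Qed.

(* The morphism X -> M^* corresponding to f : X ⊗ M -> 𝟙. *)
Definition dtransp (M : C) (D : leftDual M) (X : C) (f : mor (X ⊗ M) 𝟙) :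
  mor X D := lunit D ∘ transp D f.

Lemma dtranspK (M : C) (D : leftDual M) (X : C) (f : mor (X ⊗ M) 𝟙) :
  ev D ∘ (dtransp D f ⊗^ idm M) = f.
Proof.
rewrite /dtransp tensmMr compA.
suff -> : ev D ∘ (lunit D ⊗^ idm M) = evT D 𝟙 by exact: transpK.
by rewrite /evT -lunit1 lunit_nat -compA lunit_tens.
Qed.

Definition dualMor (X Y : C) (D : leftDual X) (E : leftDual Y) (f : mor X Y) :
  mor E D := dtransp D (ev E ∘ (idm E ⊗^ f)).

Lemma dualMorE (X Y : C) (D : leftDual X) (E : leftDual Y) (f : mor X Y) :
  ev D ∘ (dualMor D E f ⊗^ idm X) = ev E ∘ (idm E ⊗^ f).
Proof. exact: dtranspK. Qed.

Lemma dualMor1 (X : C) (D : leftDual X) : dualMor D D (idm X) = idm D.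
Proof. by apply: dual_ext; rewrite dualMorE. Qed.

Lemma dualMorM (X Y Z : C) (D : leftDual X) (E : leftDual Y) (F : leftDual Z)
    (g : mor Y Z) (f : mor X Y) :
  dualMor D F (g ∘ f) = dualMor D E f ∘ dualMor E F g.
Proof.
apply: dual_ext; rewrite dualMorE tensmMr compA dualMorE.
by rewrite -compA -tensmC compA dualMorE -compA -tensmMl.
Qed.

Lemma dualMor_lin (X Y : C) (D : leftDual X) (E : leftDual Y) a (f g : mor X Y) :
  dualMor D E (a *: f + g) = a *: dualMor D E f + dualMor D E g.
Proof.
apply: dual_ext.
by rewrite dualMorE tensm_linr tensm_linl !comp_linr !dualMorE.
Qed.

Variable A : algebraObject C.

Definition dualModule (L : leftModule A) (D : leftDual L) : rightModule A.
Proof.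
exists (ldobj D) (dtransp D (ev D ∘ (idm D ⊗^ lmact L) ∘ assoc D A L)).
- move: (dtransp D _) (dtranspK D (ev D ∘ (idm D ⊗^ lmact L) ∘ assoc D A L)).
  move=> d dE; apply: dual_ext; rewrite !tensmMr !compA dE.
  rewrite (reassoc (assoc_nat _ (idm A) (idm L))) tensm1 !compA.
  rewrite (reassoc (esym (tensmC _ (lmact L)))) !compA dE.
  have n : assoc D A L ∘ (idm (D ⊗ A) ⊗^ lmact L) =
           (idm D ⊗^ (idm A ⊗^ lmact L)) ∘ assoc D A (A ⊗ L).
    by rewrite -assoc_nat tensm1.
  rewrite (reassoc n) !compA.
  rewrite (reassoc (assoc_nat (idm D) (amul A) (idm L))) !compA.
  rewrite (reassoc (esym (tensmMl D (lmact L) (amul A ⊗^ idm L)))) lmactA !tensmMl !compA.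
  by rewrite (reassoc3 (pentagon _ _ _ _)) !compA.
- move: (dtransp D _) (dtranspK D (ev D ∘ (idm D ⊗^ lmact L) ∘ assoc D A L)).
  move=> d dE; apply: dual_ext; rewrite tensmMr compA dE.
  rewrite (reassoc (assoc_nat (idm D) (aone A) (idm L))) !compA.
  by rewrite (reassoc (esym (tensmMl _ _ _))) lmact1 (reassoc (triangle _ _)).
Defined.

Definition dualModuleMor (L L' : leftModule A) (D : leftDual L) (D' : leftDual L')
  (f : mor L L') (fP : f ∘ lmact L = lmact L' ∘ (idm A ⊗^ f)) :
  mor (dualModule D' : modCat A) (dualModule D).
Proof.
exists (dualMor D D' f); apply/eqP; rewrite /=.
move: (dtransp D _) (dtranspK D (ev D ∘ (idm D ⊗^ lmact L) ∘ assoc D A L)).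
move=> d dE.
move: (dtransp D' _) (dtranspK D' (ev D' ∘ (idm D' ⊗^ lmact L') ∘ assoc D' A L')).
move=> d' dE'.
move: (dualMor D D' f) (dualMorE D D' f) => f' fE.
apply: dual_ext; rewrite !tensmMr !compA fE dE.
rewrite (reassoc (esym (tensmC _ f))) compA dE'.
have n : assoc D' A L' ∘ (idm (D' ⊗ A) ⊗^ f) =
         (idm D' ⊗^ (idm A ⊗^ f)) ∘ assoc D' A L.
  by rewrite -assoc_nat tensm1.
rewrite (reassoc n) !compA (reassoc (esym (tensmMl D' (lmact L') (idm A ⊗^ f)))) -fP.
rewrite (reassoc (assoc_nat _ (idm A) (idm L))) tensm1 !compA.
rewrite (reassoc (esym (tensmC _ (lmact L)))) compA fE.
by rewrite tensmMl !compA.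
Defined.

End Dual.

Section InternalHomTheory.
Variables (k : fieldType) (C : monoidalCategory k) (A : algebraObject C).

Definition mactAssoc (X Y : C) (M : modCat A) : mor ((X ⊗ Y) ▷ M) (X ▷ (Y ▷ M)).
Proof.
exists (assoc X Y M); apply/eqP; rewrite /=.
rewrite tensmMl !compA (reassoc3 (pentagon _ _ _ _)) !compA.
by rewrite -tensm1 assoc_nat.
Defined.

(* A as a right module over itself. *)
Definition regularModule : modCat A := RightModule (amulA A) (amulm1 A).

Definition amulMor : mor (A ▷ regularModule) regularModule.
Proof. by exists (amul A); apply/eqP; rewrite /= compA -amulA. Defined.

Variable H : internalHom A.

Lemma ihom_ext (X : C) (M N : modCat A) (g g' : mor X (H M N)) :
  iev H M N ∘ (g ▷^ idm M) = iev H M N ∘ (g' ▷^ idm M) -> g = g'.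
Proof. by move=> e; rewrite -(iev_icurry g) e iev_icurry. Qed.

Definition imap (M M' N N' : modCat A) (f : mor M' M) (g : mor N N') :
  mor (H M N) (H M' N') :=
  icurry H (g ∘ iev H M N ∘ (idm (H M N) ▷^ f)).

Lemma mactM (X X' X'' : C) (M M' M'' : modCat A) (f' : mor X' X'') (f : mor X X')
    (g' : mor M' M'') (g : mor M M') :
  (f' ∘ f) ▷^ (g' ∘ g) = (f' ▷^ g') ∘ (f ▷^ g).
Proof. exact/val_inj/tensmM. Qed.

Lemma mact1 (X : C) (M : modCat A) : idm X ▷^ idm M = idm (X ▷ M).
Proof. exact/val_inj/tensm1. Qed.

Lemma mactC (X X' : C) (M M' : modCat A) (f : mor X X') (g : mor M M') :
  (f ▷^ idm M') ∘ (idm X ▷^ g) = (idm X' ▷^ g) ∘ (f ▷^ idm M).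
Proof. exact/val_inj/tensmC. Qed.

Lemma imapE (M M' N N' : modCat A) (f : mor M' M) (g : mor N N') :
  iev H M' N' ∘ (imap f g ▷^ idm M') = g ∘ iev H M N ∘ (idm (H M N) ▷^ f).
Proof. exact: icurryK. Qed.

Lemma imap1 (M N : modCat A) : imap (idm M) (idm N) = idm (H M N).
Proof. by apply: ihom_ext; rewrite imapE comp1m. Qed.

Lemma imapM (M M' M'' N N' N'' : modCat A) (f : mor M' M) (f' : mor M'' M')
    (g : mor N N') (g' : mor N' N'') :
  imap (f ∘ f') (g' ∘ g) = imap f' g' ∘ imap f g.
Proof.
apply: ihom_ext; rewrite imapE -{1}(comp1m (idm (H M N))) mactM.
rewrite -(comp1m (idm M'')) mactM !compA imapE.
by rewrite (reassoc (esym (mactC _ f'))) !compA (reassoc (imapE f g)) !compA.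
Qed.

Lemma imap_linl (M M' N N' : modCat A) a (f f' : mor M' M) (g : mor N N') :
  imap (a *: f + f') g = a *: imap f g + imap f' g.
Proof.
apply: ihom_ext; rewrite imapE.
have -> : idm (H M N) ▷^ (a *: f + f') =
    a *: (idm (H M N) ▷^ f) + (idm (H M N) ▷^ f').
  exact/val_inj/tensm_linr.
have -> : (a *: imap f g + imap f' g) ▷^ idm M' =
    a *: (imap f g ▷^ idm M') + (imap f' g ▷^ idm M').
  exact/val_inj/tensm_linl.
by rewrite !comp_linr !imapE.
Qed.

Lemma imap_linr (M M' N N' : modCat A) a (f : mor M' M) (g g' : mor N N') :
  imap f (a *: g + g') = a *: imap f g + imap f g'.
Proof.
apply: ihom_ext; rewrite imapE.
have -> : (a *: imap f g + imap f g') ▷^ idm M' =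
    a *: (imap f g ▷^ idm M') + (imap f g' ▷^ idm M').
  exact/val_inj/tensm_linl.
by rewrite comp_linr !comp_linl !imapE.
Qed.

Definition ihomFunctor (M : modCat A) : functor (modCat A) C.
Proof.
exists (H M) (fun N N' g => imap (idm M) g).
- by move=> N; rewrite imap1.
- by move=> N N' N'' g' g; rewrite -imapM comp1m.
- by move=> N N' a g g'; rewrite imap_linr.
Defined.

Definition Cprojective (P : modCat A) : Prop := exactFunctor (ihomFunctor P).

(* The left A-module Hom_A(M, A). *)
Definition ihomAct (M : modCat A) :
  mor (A ⊗ H M regularModule) (H M regularModule) :=
  icurry H (amulMor ∘ (idm A ▷^ iev H M regularModule) ∘
            mactAssoc A (H M regularModule) M).

Lemma ihomActE (M : modCat A) :
  mmor (iev H M regularModule) ∘ (ihomAct M ⊗^ idm M) =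
  amul A ∘ (idm A ⊗^ mmor (iev H M regularModule)) ∘
    assoc A (H M regularModule) M.
Proof. exact: (congr1 (@mmor _ _ _ _ _) (icurryK H (amulMor ∘ _ ∘ _))). Qed.

Definition ihomLeft (M : modCat A) : leftModule A.
Proof.
exists (H M regularModule) (ihomAct M).
- move: (ihomAct M) (ihomActE M) => a aE.
  apply: ihom_ext; apply: val_inj; rewrite /= !tensmMr !compA aE.
  rewrite (reassoc (assoc_nat _ _ _)) tensm1 !compA.
  rewrite (reassoc (esym (tensmC (amul A) _))) compA amulA.
  rewrite (reassoc (assoc_nat _ _ _)) !compA.
  rewrite (reassoc (esym (tensmMl A (mmor (iev H M regularModule)) (a ⊗^ idm (M : rightModule A))))) aE !tensmMl !compA.
  rewrite (reassoc3 (pentagon _ _ _ _)) !compA.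
  rewrite (reassoc (esym (assoc_nat (idm A) (idm A) _))) tensm1 !compA.
  by [].
- move: (ihomAct M) (ihomActE M) => a aE.
  apply: ihom_ext; apply: val_inj; rewrite /= !tensmMr !compA aE.
  rewrite (reassoc (assoc_nat _ _ _)) tensm1 !compA.
  rewrite (reassoc (esym (tensmC (aone A) _))) compA amul1m.
  by rewrite lunit_nat -compA lunit_tens.
Defined.

Lemma imap_ihomAct (M M' : modCat A) (f : mor M' M) :
  imap f (idm regularModule) ∘ ihomAct M =
  ihomAct M' ∘ (idm A ⊗^ imap f (idm regularModule)).
Proof.
have fE : mmor (iev H M' regularModule) ∘
    (imap f (idm regularModule) ⊗^ idm M') =
    mmor (iev H M regularModule) ∘ (idm (H M regularModule) ⊗^ mmor f).
  by have /(congr1 val) := imapE f (idm regularModule); rewrite /= comp1m.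
move: (imap f _) fE => g gE.
move: (ihomAct M) (ihomActE M) (ihomAct M') (ihomActE M') => a aE a' aE'.
apply: ihom_ext; apply: val_inj; rewrite /= !tensmMr !compA aE' gE.
rewrite (reassoc (esym (tensmC a _))) compA aE.
rewrite (reassoc (assoc_nat _ _ _)) !compA.
rewrite (reassoc (esym (tensmMl A (mmor (iev H M' regularModule)) (g ⊗^ idm (M' : rightModule A))))) gE tensmMl !compA.
by rewrite -tensm1 (reassoc (assoc_nat _ _ _)) !compA.
Qed.

End InternalHomTheory.
Arguments iev {k C A} i M N.
Arguments imap {k C A} H {M M' N N'} f g.

Section Serre.
Variables (k : fieldType) (C : finiteTensorCategory k) (A : algebraObject C).
Variable H : internalHom A.

Definition serreObj (M : modCat A) : modCat A :=
  dualModule (L := ihomLeft H M) (ldual (H M (regularModule A))).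

Definition serreMor (M N : modCat A) (f : mor M N) :
  mor (serreObj M) (serreObj N) :=
  dualModuleMor (L := ihomLeft H N) (L' := ihomLeft H M)
    (ldual _) (ldual _) (imap_ihomAct H f).

Definition serreFunctor : functor (modCat A) (modCat A).
Proof.
exists serreObj serreMor.
- by move=> M; apply: val_inj; rewrite /= imap1 dualMor1.
- move=> M N K g f; apply: val_inj.
  have e : imap H (g ∘ f) (idm (regularModule A)) =
      imap H f (idm (regularModule A)) ∘ imap H g (idm (regularModule A)).
    by rewrite -imapM comp1m.
  exact: etrans (congr1 (dualMor _ _) e) (dualMorM _ _ _ _ _).
- move=> M N a f g; apply: val_inj; rewrite /= imap_linl.
  exact: dualMor_lin.
Defined.

Definition isRelativeSerre (S : functor (modCat A) (modCat A)) : Prop :=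
  rightExact S /\
  exists phi : forall P M : modCat A,
      Cprojective H P -> mor (ldual (H P M)) (H M (S P)),
    (forall P M (hP : Cprojective H P), isIso (phi P M hP)) /\
    (forall (P P' M M' : modCat A) (hP : Cprojective H P)
        (hP' : Cprojective H P') (p : mor P P') (m : mor M' M),
      imap H m (fmap S p) ∘ phi P M hP =
      phi P' M' hP' ∘ dualMor (ldual (H P' M')) (ldual (H P M)) (imap H p m)).

End Serre.

Definition hasKernels (k : fieldType) (C : linearCategory k) : Prop :=
  forall (X Y : C) (f : mor X Y), exists (K : C) (i : mor K X), isKernel f i.

Lemma fdact0 (k : fieldType) (R : falgType k) (V : fdModule R) a :
  fdact (0 : V) a = 0.
Proof.
by have := fdact_linl (-1) 0 (0 : V) a; rewrite scaler0 addr0 scaleN1r addNr.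
Qed.

Lemma fd_hasKernels (k : fieldType) (R : falgType k) : hasKernels (fdCategory R).
Proof.
move=> V W f; set U := lker (fdh f).
have fP v : (v \in U) = (fdh f v == 0) by rewrite memv_ker.
have stab (v : subvs_of U) a : fdact (vsval v) a \in U.
  rewrite fP fdhE; have := subvsP v.
  by rewrite fP => /eqP ->; rewrite fdact0.
pose act (v : subvs_of U) a : subvs_of U := vsproj U (fdact (vsval v) a).
have actE v a : vsval (act v a) = fdact (vsval v) a by rewrite vsprojK.
have a1 v : act v 1 = v by apply: val_inj; rewrite /= actE fdact1.
have aM v a b : act v (a * b) = act (act v a) b.
  by apply: val_inj; rewrite /= !actE fdactM.
have al c v w a : act (c *: v + w) a = c *: act v a + act w a.
  by apply: val_inj; rewrite /= !actE; exact: fdact_linl.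
have ar c v a b : act v (c *: a + b) = c *: act v a + act v b.
  by apply: val_inj; rewrite /= !actE; exact: fdact_linr.
pose K := FdModule a1 aM al ar.
have iP : linfun (vsval : subvs_of U -> V) \in @fdLinear _ _ K V.
  by apply/asboolP => v a; rewrite !lfunE /= actE.
exists (K : fdCategory R), (FdHom iP : mor (K : fdCategory R) V); split.
  apply: val_inj; apply/lfunP => v; rewrite /= comp_lfunE !lfunE /=.
  by apply/eqP; rewrite -fP subvsP.
move=> T h fh.
have hU v : fdh h v \in U.
  rewrite fP; have /(congr1 (fun g : fdHom T W => fdh g v)) := fh.
  by rewrite /= comp_lfunE => ->; rewrite zero_lfunE.
have uP : (linfun (vsproj U) \o fdh h)%VF \in @fdLinear _ _ T K.
  apply/asboolP => v a; rewrite !comp_lfunE !lfunE /= fdhE.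
  by apply: val_inj; rewrite /= actE !vsprojK // -fdhE.
exists (FdHom uP : mor T (K : fdCategory R)); split.
  apply: val_inj; apply/lfunP => v.
  by rewrite /= !comp_lfunE !lfunE /= vsprojK.
move=> u' /(congr1 (fun g : fdHom T V => fdh g)) e; apply: val_inj; apply/lfunP => v.
rewrite /= comp_lfunE lfunE /= -e /= comp_lfunE lfunE /=.
by apply: val_inj; rewrite /= vsprojK // subvsP.
Qed.

Lemma fmap0 (k : fieldType) (C D : linearCategory k) (F : functor C D)
  (X Y : C) : fmap F (0 : mor X Y) = 0.
Proof.
have := fmap_lin F (-1) (0 : mor X Y) 0.
by rewrite scaler0 addr0 scaleN1r addNr.
Qed.

Lemma equivalent_hasKernels (k : fieldType) (C D : linearCategory k) :
  equivalent C D -> hasKernels D -> hasKernels C.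
Proof.
move=> [F [G [[eta [etaI etaN]] [eps [epsI epsN]]]]] kerD X Y f.
have [K [i [fi iU]]] := kerD _ _ (fmap F f).
have /= nat_eta := etaN; have /= nat_eps := epsN.
have iM W (u v : mor W K) : i ∘ u = i ∘ v -> u = v.
  move=> e; have [|w [_ wU]] := iU W (i ∘ u); first by rewrite compA fi comp0m.
  by rewrite -(wU u) // -(wU v).
exists (G K), (eta X ∘ fmap G i); split.
  by rewrite compA nat_eta -compA -fmapM fi fmap0 compm0.
move=> W h fh.
have [|u [uE _]] := iU _ (fmap F h); first by rewrite -fmapM fh fmap0.
have [t [tW Wt]] := etaI W.
exists (fmap G u ∘ t); split.
  by rewrite compA -(compA (eta X)) -fmapM uE -nat_eta -compA Wt compm1.
move=> v vE; have [s [sX Xs]] := etaI X; have [r [rK Kr]] := epsI K.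
have e : fmap G i ∘ (fmap G u ∘ t) = fmap G i ∘ v.
  apply: compm_canl sX _; rewrite [RHS]compA vE (compA (fmap G i)) -fmapM uE.
  by rewrite compA -nat_eta -compA Wt compm1.
have FGi W' (x y : mor W' (G K)) :
    fmap G i ∘ x = fmap G i ∘ y -> x = y.
  move=> exy.
  have Fxy : fmap F x = fmap F y.
    have eF : fmap F (fmap G i) ∘ fmap F x = fmap F (fmap G i) ∘ fmap F y.
      by rewrite -!fmapM exy.
    have : eps K ∘ fmap F x = eps K ∘ fmap F y.
      by apply: iM; rewrite !compA nat_eps -!compA eF.
    exact: compm_canl rK.
  have [q [qG Gq]] := etaI W'.
  have : x ∘ eta W' = y ∘ eta W' by rewrite !nat_eta Fxy.
  by move/(congr1 (fun z => z ∘ q)); rewrite -!compA Gq !compm1.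
exact: FGi.
Qed.

Lemma finiteAbelian_hasKernels (k : fieldType) (C : linearCategory k) :
  finiteAbelian C -> hasKernels C.
Proof. by case=> R /equivalent_hasKernels; apply; apply: fd_hasKernels. Qed.

Lemma tens0m (k : fieldType) (C : monoidalCategory k) (X X' Y Y' : C)
  (g : mor Y Y') : (0 : mor X X') ⊗^ g = 0.
Proof.
have := tensm_linl (-1) (0 : mor X X') 0 g.
by rewrite scaler0 addr0 scaleN1r addNr.
Qed.

Lemma transp0 (k : fieldType) (C : monoidalCategory k) (M : C) (D : leftDual M)
  (X N : C) : transp D (0 : mor (X ⊗ M) N) = 0.
Proof. by rewrite /transp tens0m !comp0m. Qed.

Lemma transp_nat (k : fieldType) (C : monoidalCategory k) (M : C)
    (D : leftDual M) (X Y N : C) (f : mor (Y ⊗ M) N) (g : mor X Y) :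
  transp D (f ∘ (g ⊗^ idm M)) = transp D f ∘ g.
Proof. by rewrite -{1}(transpK D f) -compA -tensmMr transp_evT. Qed.

Section InternalHomExistence.
Variables (k : fieldType) (C : finiteTensorCategory k) (A : algebraObject C).

(* The internal Hom from M to N is the kernel of a morphism
   N ⊗ M^* -> N ⊗ (M ⊗ A)^*. *)
Lemma ihom_exists (M N : modCat A) :
  exists (E : C) (e : mor (E ▷ M) N),
    forall (X : C) (f : mor (X ▷ M) N), exists! g : mor X E, e ∘ (g ▷^ idm M) = f.
Proof.
pose MC := rmo M; pose NC := rmo N.
pose D := ldual MC; pose DA := ldual (MC ⊗ A).
pose d X (f : mor (X ⊗ MC) NC) : mor (X ⊗ (MC ⊗ A)) NC :=
  f ∘ (idm X ⊗^ ract M) - ract N ∘ (f ⊗^ idm A) ∘ assocV X MC A.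
have dE X Y (f : mor (Y ⊗ MC) NC) (g : mor X Y) :
    d X (f ∘ (g ⊗^ idm MC)) = d Y f ∘ (g ⊗^ idm (MC ⊗ A)).
  rewrite /d compBl -!compA tensmC; congr (_ - _).
  by rewrite tensmMr -!compA -[idm (MC ⊗ A)]tensm1 assocV_nat.
have dP X (f : mor (X ⊗ MC) NC) : d X f = 0 <->
    f ∘ ((idm X ⊗^ ract M) ∘ assoc X MC A) = ract N ∘ (f ⊗^ idm A).
  rewrite /d; split=> [/eqP|e].
    rewrite subr_eq0 => /eqP e; rewrite compA e -!compA assocK.
    by rewrite compm1.
  apply/eqP; rewrite subr_eq0; apply/eqP.
  by rewrite -e compA -!compA assocVK compm1.
have d0 X (f : mor (X ⊗ MC) NC) :
    d X f = 0 <-> transp DA (d _ (evT D NC)) ∘ transp D f = 0.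
  rewrite -transp_nat -dE transpK; split=> [->|e]; first exact: transp0.
  by rewrite -(transpK DA (d X f)) e tens0m compm0.
have [E [i [di iU]]] := finiteAbelian_hasKernels (ftc_finite C)
  (transp DA (d _ (evT D NC))).
have eP : evT D NC ∘ (i ⊗^ idm MC) \in @rlinear _ _ A (E ▷ M) N.
  by apply/eqP/dP/d0; rewrite transp_evT.
exists E, (ModuleMor eP : mor (E ▷ M) N) => X f.
have [|u [uE uU]] := iU X (transp D (mmor f)).
  by apply/d0/dP; exact: (mmorE (f : moduleMor (X ▷ M) N)).
exists u; split.
  by apply: val_inj; rewrite /= -compA -tensmMr uE transpK.
move=> u' /(congr1 (fun g => mmor g)) /= fE; apply: uU.
by rewrite -fE -compA -tensmMr transp_evT.
Qed.

Lemma internalHom_exists : inhabited (internalHom A).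
Proof.
pose E M N := sval (cid (ihom_exists M N)).
pose e M N : mor (E M N ▷ M) N := sval (cid (svalP (cid (ihom_exists M N)))).
have eP M N X (f : mor (X ▷ M) N) :
    exists! g : mor X (E M N), e M N ∘ (g ▷^ idm M) = f.
  exact: (svalP (cid (svalP (cid (ihom_exists M N))))).
pose c X M N (f : mor (X ▷ M) N) : mor X (E M N) := sval (cid (eP M N X f)).
have cP X M N (f : mor (X ▷ M) N) : e M N ∘ (c X M N f ▷^ idm M) = f.
  by have [] := svalP (cid (eP M N X f)).
constructor; exists E e c => // X M N g.
by have [_] := svalP (cid (eP M N X (e M N ∘ (g ▷^ idm M)))); apply.
Qed.

End InternalHomExistence.

(* Main.v *)
(* Write D for left duals and L = Hom_A(P, A).  On C-projective P the functor
   Hom_A(P, -) is exact and commutes with X ⊗ -, so applying it to the bar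
   presentation M ⊗ A ⊗ A -> M ⊗ A -> M -> 0 gives Hom_A(P, M) = M ⊗_A L.
   Maps X -> D(M ⊗_A L) are balanced maps X ⊗ M ⊗ L -> 𝟙, that is A-linear maps
   X ⊗ M -> D L, that is maps X -> Hom_A(M, D L); conclude by Yoneda.
   Right exactness of D Hom_A(-, A): X ⊗ - preserves cokernels of A-modules, so
   Hom_A(-, A) turns them into kernels, which duality turns back into cokernels
   in C; these are cokernels of A-modules because - ⊗ A preserves epimorphisms. *)
Require Import Defs.
From HB Require Import structures.
From mathcomp Require Import all_boot all_order all_algebra all_field.
From mathcomp Require Import boolp.
Import Defs.

Set Implicit Arguments.
Unset Strict Implicit.
Unset Printing Implicit Defensive.

Import GRing.Theory.
Local Open Scope ring_scope.
Local Open Scope cat_scope.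

(** * Cokernels and right exact functors in linear categories *)

Lemma compKm (k : fieldType) (C : linearCategory k) (X Y Z : C) (f : mor X Y)
    (g : mor Y X) : g ∘ f = idm X -> forall x : mor X Z, x ∘ g ∘ f = x.
Proof. by move=> gf x; rewrite -compA gf compm1. Qed.

Section LinearCategories.
Variable k : fieldType.

Lemma cokernel_epi (C : linearCategory k) (X Y Q : C) (f : mor X Y) (p : mor Y Q) :
  isCokernel f p -> forall W (u v : mor Q W), u ∘ p = v ∘ p -> u = v.
Proof.
move=> [pf pU] W u v e.
have [|w [_ wU]] := pU W (u ∘ p); first by rewrite -compA pf compm0.
by rewrite -(wU u) // -(wU v).
Qed.

Lemma cokernel_iso (C : linearCategory k) (X Y Q X' Y' : C) (f : mor X Y)
    (p : mor Y Q) (f' : mor X' Y') (x : mor X' X) (y : mor Y' Y) :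
  isIso x -> isIso y -> y ∘ f' = f ∘ x -> isCokernel f p -> isCokernel f' (p ∘ y).
Proof.
move=> [x' [_ xx']] [y' [y'y yy']] e [pf pU]; split.
  by rewrite -compA e compA pf comp0m.
move=> W h hf'.
have hf : h ∘ y' ∘ f = 0.
  by rewrite -[_ ∘ f]compm1 -xx' !compA -!(compA h) -(compA y') -e !compA -(compA h)
    y'y compm1 hf' comp0m.
have [u [uE uU]] := pU _ _ hf; exists u; split.
  by rewrite compA uE -compA y'y compm1.
by move=> v vE; apply: uU; rewrite -vE !compA -compA yy' compm1.
Qed.

(* A functor with a right adjoint, the latter given by its counit. *)
Lemma leftAdjoint_rightExact (C D : linearCategory k) (F : functor C D) :
  (forall W : D, exists (G : C) (e : mor (F G) W),
     forall Z (f : mor (F Z) W), exists! g : mor Z G, e ∘ fmap F g = f) ->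
  rightExact F.
Proof.
move=> adj X Y Q f p [pf pU]; split; first by rewrite -fmapM pf fmap0.
move=> W h hf; have [G [e eU]] := adj W.
have eI Z (a b : mor Z G) : e ∘ fmap F a = e ∘ fmap F b -> a = b.
  by move=> ab; have [c [_ cU]] := eU Z (e ∘ fmap F a); rewrite -(cU a) // -(cU b).
(* [h'] is the transpose of [h]. It kills [f], so it factors through the cokernel in [C], and
   transposing that factor back gives the one for [h]. *)
have [h' [h'E _]] := eU _ h.
have h'f : h' ∘ f = 0 by apply: eI; rewrite fmapM compA h'E hf fmap0 compm0.
have [u [uE uU]] := pU _ _ h'f.
exists (e ∘ fmap F u); split; first by rewrite -compA -fmapM uE.
move=> v vE; have [v' [v'E _]] := eU _ v; rewrite -v'E; congr (_ ∘ fmap F _).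
by apply: uU; apply: eI; rewrite fmapM compA v'E vE.
Qed.

End LinearCategories.

(** * The reversed monoidal category *)

Section Reversed.
Variables (k : fieldType) (C : monoidalCategory k).

(** Reversing the tensor product exchanges left and right duals, so each result about [transp] and
    [ev] yields its mirror image without a second proof. *)
Definition revMonoidal : monoidalCategory k.
Proof.
unshelve refine (@MonoidalCategory k C (fun X Y => Y ⊗ X)
  (fun X X' Y Y' f g => g ⊗^ f) 𝟙
  (fun X Y Z => assocV Z Y X) (fun X Y Z => assoc Z Y X)
  (fun X => runit X) (fun X => runitV X) (fun X => lunit X) (fun X => lunitV X)
  _ _ _ _ _ _ _ _ _ _ _ _ _ _ _) => /=.
- by move=> X Y; exact: tensm1.
- by move=> *; exact: tensmM.
- by move=> *; exact: tensm_linr.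
- by move=> *; exact: tensm_linl.
- by move=> *; exact: assocVK.
- by move=> *; exact: assocK.
- by move=> *; exact: runitK.
- by move=> *; exact: runitVK.
- by move=> *; exact: lunitK.
- by move=> *; exact: lunitVK.
- by move=> *; exact: assocV_nat.
- by move=> *; exact: runit_nat.
- by move=> *; exact: lunit_nat.
- move=> W X Y Z.
  (* The right-hand side is the inverse of this [u]. After composing with [u], rewritten on the left
     by the original pentagon, both sides are the identity. *)
  apply: (compm_canl (u := assoc Z Y (X ⊗ W) ∘ assoc (Z ⊗ Y) X W)
    (v := assocV (Z ⊗ Y) X W ∘ assocV Z Y (X ⊗ W))).
    by rewrite compA (compKm (assocK _ _ _)) assocK.
  rewrite -{1}pentagon !compA (compKm (assocVK _ _ _)) assocVK.
  rewrite (compKm (_ : (assoc Z Y X ⊗^ idm W) ∘ _ = idm _)); last first.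
    by rewrite -tensmMr assocVK tensm1.
  by rewrite (compKm (assocVK _ _ _)) -tensmMl assocVK tensm1.
- by move=> X Y; rewrite -triangle -compA assocVK compm1.
Defined.

Definition rightDual_leftDual (M : C) (R : rightDual M) :
  @leftDual k revMonoidal M :=
  LeftDual (rdual_zig R : _ = _ :> @mor k revMonoidal _ _) (rdual_zag R).

End Reversed.

(* (R ⊗ N, levT R N) is universal among pairs (X, f : M ⊗ X -> N); this mirrors
   evT, so its universality is that of evT in the reversed category.  Locking
   keeps compA from matching inside these morphisms. *)
HB.lock Definition levT (k : fieldType) (C : monoidalCategory k) (M : C)
  (R : rightDual M) (N : C) : mor (M ⊗ (R ⊗ N)) N :=
  lunit N ∘ (rdev R ⊗^ idm N) ∘ assocV M R N.
Arguments levT {k C M} R N.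

HB.lock Definition ltransp (k : fieldType) (C : monoidalCategory k) (M : C)
  (R : rightDual M) (X N : C) (f : mor (M ⊗ X) N) : mor X (R ⊗ N) :=
  @transp _ (revMonoidal C) _ (rightDual_leftDual R) X N f.
Arguments ltransp {k C M} R {X N} f.

(** * Left transposition, duality of morphisms and exactness of the tensor product *)

Section LeftTransposition.
Variables (k : fieldType) (C : monoidalCategory k).

Lemma ltranspK (M : C) (R : rightDual M) (X N : C) (f : mor (M ⊗ X) N) :
  levT R N ∘ (idm M ⊗^ ltransp R f) = f.
Proof.
rewrite levT.unlock ltransp.unlock.
exact: (@transpK k (revMonoidal C) M (rightDual_leftDual R) X N f).
Qed.

Lemma ltransp_levT (M : C) (R : rightDual M) (X N : C) (g : mor X (R ⊗ N)) :
  ltransp R (levT R N ∘ (idm M ⊗^ g)) = g.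
Proof.
rewrite levT.unlock ltransp.unlock.
exact: (@transp_evT k (revMonoidal C) M (rightDual_leftDual R) X N g).
Qed.

Lemma ltransp_inj (M : C) (R : rightDual M) (X N : C) (g g' : mor X (R ⊗ N)) :
  levT R N ∘ (idm M ⊗^ g) = levT R N ∘ (idm M ⊗^ g') -> g = g'.
Proof. by move=> e; rewrite -(ltransp_levT g) e ltransp_levT. Qed.

Lemma levT_nat (M : C) (R : rightDual M) (N N' : C) (f : mor N N') :
  levT R N' ∘ (idm M ⊗^ (idm R ⊗^ f)) = f ∘ levT R N.
Proof.
rewrite levT.unlock -compA assocV_nat tensm1 !compA.
by rewrite (reassoc (tensmC _ f)) compA lunit_nat.
Qed.

(** This is the pentagon for [M], [R], [N], [Y]. With [Y = A] it gives the [A]-linearity of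
    [levT]. *)
Lemma levT_tens (M : C) (R : rightDual M) (N Y : C) :
  levT R N ⊗^ idm Y =
  levT R (N ⊗ Y) ∘ (idm M ⊗^ assoc R N Y) ∘ assoc M (R ⊗ N) Y.
Proof.
have pent : assoc (M ⊗ R) N Y ∘ (assocV M R N ⊗^ idm Y) =
  assocV M R (N ⊗ Y) ∘ (idm M ⊗^ assoc R N Y) ∘ assoc M (R ⊗ N) Y.
  apply: (compm_canl (u := assoc _ _ _) (v := assocV _ _ _)); first exact: assocK.
  rewrite !compA assocVK comp1m -pentagon compKm //.
  by rewrite -tensmMr assocVK tensm1.
rewrite levT.unlock !tensmMr -lunit_tens.
rewrite (reassoc (assoc_nat (rdev R) (idm N) (idm Y))) tensm1 !compA.
by rewrite (reassoc pent) !compA.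
Qed.

Definition leftDual_rightDual (M : C) (D : leftDual M) : rightDual (D : C) :=
  RightDual (ldual_zag D) (ldual_zig D).

Definition rightDual_dual (M : C) (R : rightDual M) : leftDual (R : C) :=
  LeftDual (rdual_zag R) (rdual_zig R).

Lemma dual_extr (M : C) (D : leftDual M) (X : C) (g g' : mor X M) :
  ev D ∘ (idm (D : C) ⊗^ g) = ev D ∘ (idm (D : C) ⊗^ g') -> g = g'.
Proof.
exact: (@dual_ext _ (revMonoidal C) _ (rightDual_leftDual (leftDual_rightDual D))).
Qed.

Lemma dtranspr_exists (M : C) (D : leftDual M) (X : C) (f : mor (D ⊗ X) 𝟙) :
  exists g : mor X M, ev D ∘ (idm (D : C) ⊗^ g) = f.
Proof.
pose D' := rightDual_leftDual (leftDual_rightDual D).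
exists (@dtransp _ (revMonoidal C) _ D' X f).
exact: (@dtranspK _ (revMonoidal C) _ D').
Qed.

Lemma dualMor_inj (X Y : C) (D : leftDual X) (E : leftDual Y) (f g : mor X Y) :
  dualMor D E f = dualMor D E g -> f = g.
Proof. by move=> e; apply: (dual_extr (D := E)); rewrite -!(dualMorE D) e. Qed.

Lemma dualMor_surj (X Y : C) (D : leftDual X) (E : leftDual Y) (h : mor E D) :
  exists f, dualMor D E f = h.
Proof.
have [f fE] := dtranspr_exists (D := E) (ev D ∘ (h ⊗^ idm X)).
by exists f; apply: dual_ext; rewrite dualMorE fE.
Qed.

Lemma dualMor0 (X Y : C) (D : leftDual X) (E : leftDual Y) :
  dualMor D E (0 : mor X Y) = 0.
Proof.
by have := dualMor_lin D E (-1) 0 0; rewrite scaler0 addr0 scaleN1r addNr.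
Qed.

(** Duality is full and faithful, and every object is the left dual of its right dual. So the test
    object may be taken to be a left dual, and the universal property is that of the kernel with
    arrows reversed. *)
Lemma dual_cokernel (X Y K : C) (DX : leftDual X) (DY : leftDual Y)
    (DK : leftDual K) (f : mor X Y) (i : mor K X) :
  (forall W : C, rightDual W) ->
  isKernel f i -> isCokernel (dualMor DX DY f) (dualMor DK DX i).
Proof.
move=> rd [fi iU]; split; first by rewrite -dualMorM fi dualMor0.
move=> W; pose DW := rightDual_dual (rd W); rewrite -[W]/(ldobj DW).
move: DW => DW h; have [h' <-] := dualMor_surj h.
rewrite -dualMorM -(dualMor0 DW DY) => /dualMor_inj /iU[u [uE uU]].
exists (dualMor DW DK u); split; first by rewrite -dualMorM uE.
move=> v; have [v' <-] := dualMor_surj v.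
by rewrite -dualMorM => /dualMor_inj /uU ->.
Qed.

Definition tenslFunctor (X : C) : functor C C.
Proof.
exists (fun Y => X ⊗ Y) (fun Y Y' f => idm X ⊗^ f).
- by move=> Y; rewrite tensm1.
- by move=> Y Y' Y'' g f; rewrite tensmMl.
- by move=> Y Y' a f f'; rewrite tensm_linr.
Defined.

Lemma tensl_rightExact (X : C) (R : rightDual X) : rightExact (tenslFunctor X).
Proof.
apply: leftAdjoint_rightExact => W.
exists (R ⊗ W), (levT R W) => Z f.
exists (ltransp R f); split; first exact: ltranspK.
by move=> g <-; rewrite ltransp_levT.
Qed.

Definition tensrFunctor (Y : C) : functor C C.
Proof.
exists (fun X => X ⊗ Y) (fun X X' f => f ⊗^ idm Y).
- by move=> X; rewrite tensm1.
- by move=> X X' X'' g f; rewrite tensmMr.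
- by move=> X X' a f f'; rewrite tensm_linl.
Defined.

Lemma tensr_rightExact (Y : C) (D : leftDual Y) : rightExact (tensrFunctor Y).
Proof.
apply: leftAdjoint_rightExact => W.
exists (W ⊗ D), (evT D W) => Z f.
exists (transp D f); split; first exact: transpK.
by move=> g <-; rewrite transp_evT.
Qed.

End LeftTransposition.

(** * Cokernels of modules, and their behaviour under the action of [C] and under the internal
    Hom *)

Section ModuleCategory.
Variables (k : fieldType) (C : monoidalCategory k) (A : algebraObject C).
Implicit Types M N P : modCat A.

Definition mactFunctor (X : C) : functor (modCat A) (modCat A).
Proof.
exists (fun M => X ▷ M) (fun M N f => idm X ▷^ f).
- by move=> M; exact/val_inj/tensm1.
- by move=> M N K g f; exact/val_inj/tensmMl.
- by move=> M N a f g; exact/val_inj/tensm_linr.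
Defined.

Lemma levT_rlinear (X : C) (R : rightDual X) N :
  levT R (rmo N) \in @rlinear _ _ A (X ▷ (R ▷ N)) N.
Proof.
apply/eqP; rewrite /= levT_tens tensmMl !compA.
by rewrite levT_nat.
Qed.

Definition levTm (X : C) (R : rightDual X) N : mor (X ▷ (R ▷ N)) N :=
  ModuleMor (levT_rlinear R N).

(** Together with [levT_rlinear] this restricts the adjunction between [X ⊗ -] and [R ⊗ -] to
    modules, which makes [X ▷ -] right exact. *)
Lemma ltransp_rlinear (X : C) (R : rightDual X) M N (f : mor (X ▷ M) N) :
  ltransp R (mmor f) \in @rlinear _ _ A M (R ▷ N).
Proof.
apply/eqP; apply: (ltransp_inj (R := R)) => /=.
rewrite tensmMl compA ltranspK !tensmMl !compA levT_nat.
apply: (compm_canr (u := assoc X (rmo M) A) (v := assocV X (rmo M) A)).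
  exact: assocVK.
have := mmorE (f : moduleMor (X ▷ M) N); rewrite /= !compA => ->.
rewrite -[in LHS](ltranspK R (mmor f)) tensmMr levT_tens !compA.
by rewrite (reassoc (assoc_nat _ _ _)) !compA.
Qed.

Lemma mact_rightExact (X : C) (R : rightDual X) : rightExact (mactFunctor X).
Proof.
apply: leftAdjoint_rightExact => W.
exists (R ▷ W), (levTm R W) => Z f.
exists (ModuleMor (ltransp_rlinear R f) : mor Z (R ▷ W)); split.
  by apply: val_inj; exact: ltranspK.
move=> g <-; apply: val_inj; exact: ltransp_levT.
Qed.

(** The factorization found in [C] is automatically [A]-linear: [- ⊗ A] is right exact, so [p ⊗ A]
    is an epimorphism and linearity can be tested after composing with it. *)
Lemma cokernel_modCat (D : leftDual (A : C)) M N Q (f : mor M N) (p : mor N Q) :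
  isCokernel (mmor f) (mmor p) -> isCokernel f p.
Proof.
move=> fp; have [pf pU] := fp; split; first exact: val_inj.
move=> W h /(congr1 val) /= hf.
have [u [uE uU]] := pU _ _ hf.
have uP : u \in @rlinear _ _ A Q W.
  apply/eqP; apply: (cokernel_epi (tensr_rightExact D fp)) => /=.
  rewrite -compA -[X in _ ∘ X](mmorE (p : moduleMor N Q)) compA uE.
  by rewrite -compA -tensmMr uE; exact: (mmorE (h : moduleMor N W)).
exists (ModuleMor uP : mor Q W); split; first exact: val_inj.
by move=> v /(congr1 val) /= vE; apply: val_inj; exact: uU.
Qed.

Variable H : internalHom A.

(** By adjunction, maps out of [X] killed by [imap H f (idm W)] are maps [X ▷ N -> W] killed by
    [X ▷ f]. These factor uniquely through [X ▷ p] because [X ▷ -] is right exact. *)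
Lemma ihom_kernel (rd : forall X : C, rightDual X) M N Q W (f : mor M N)
    (p : mor N Q) :
  isCokernel f p -> isKernel (imap H f (idm W)) (imap H p (idm W)).
Proof.
move=> fp; split.
  rewrite -imapM comp1m (proj1 fp).
  have := imap_linl H (-1) (0 : mor M Q) 0 (idm W).
  by rewrite scaler0 addr0 scaleN1r addNr.
move=> X h hf.
have Xfp := mact_rightExact (rd X) fp.
have hp : iev H N W ∘ (h ▷^ idm N) ∘ (idm X ▷^ f) = 0.
  have := congr1 (fun z => iev H M W ∘ (z ▷^ idm M)) hf.
  rewrite -{1}(comp1m (idm M)) mactM compA imapE comp1m -!compA -mactC => ->.
  by apply: val_inj; rewrite /= tens0m compm0.
have [u [uE uU]] := (proj2 Xfp) _ _ hp.
exists (icurry H u); split.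
  apply: (@ihom_ext _ _ _ H).
  rewrite -{1}(comp1m (idm N)) mactM compA imapE comp1m -compA -mactC compA icurryK.
  exact: uE.
move=> v vE; rewrite (uU (iev H Q W ∘ (v ▷^ idm Q))) ?iev_icurry //.
rewrite -[fmap _ p]/(idm X ▷^ p) -compA mactC compA -[iev H Q W]comp1m -imapE.
by rewrite -compA -mactM vE comp1m.
Qed.

End ModuleCategory.

(** * Balanced maps and the tensor product over [A] *)

Section Balanced.
Variables (k : fieldType) (C : monoidalCategory k) (A : algebraObject C).

(* The tensor product M ⊗_A L is the cokernel of the balancer. *)
Definition balancer (M : rightModule A) (L : leftModule A) :
  mor (rmo M ⊗ A ⊗ lmo L) (rmo M ⊗ lmo L) :=
  (ract M ⊗^ idm (lmo L)) - (idm (rmo M) ⊗^ lmact L) ∘ assoc (rmo M) A (lmo L).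

Lemma dualModule_ractE (L : leftModule A) (D : leftDual (lmo L)) :
  ev D ∘ (ract (dualModule D) ⊗^ idm (lmo L)) =
  ev D ∘ (idm (D : C) ⊗^ lmact L) ∘ assoc (D : C) A (lmo L).
Proof. exact: dtranspK. Qed.

(** A map into the dual module is determined by its pairing with [L]. Under this pairing the two
    sides of the linearity equation become the two terms of the balancer, preceded by the same
    invertible associators. *)
Lemma dualModule_linear (X : C) (M : modCat A) (L : leftModule A)
    (D : leftDual (lmo L)) (b : mor (X ⊗ rmo M) D) :
  b \in @rlinear _ _ A (X ▷ M) (dualModule D) <->
  ev D ∘ (b ⊗^ idm (lmo L)) ∘ assocV X (rmo M) (lmo L) ∘
    (idm X ⊗^ balancer M L) = 0.
Proof.
pose c := ev D ∘ (b ⊗^ idm (lmo L)) ∘ assocV X (rmo M) (lmo L).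
have bE : ev D ∘ (b ⊗^ idm (lmo L)) = c ∘ assoc X (rmo M) (lmo L).
  by rewrite /c compKm ?assocK.
rewrite -/c; move: c bE => c bE.
have e1 : ev D ∘ ((b ∘ ract (X ▷ M : rightModule A)) ⊗^ idm (lmo L)) =
    c ∘ (idm X ⊗^ (ract M ⊗^ idm (lmo L))) ∘ assoc X (rmo M ⊗ A) (lmo L) ∘
    (assoc X (rmo M) A ⊗^ idm (lmo L)).
  rewrite /= !tensmMr !compA bE.
  by rewrite (reassoc (assoc_nat _ _ _)) !compA.
have e2 : ev D ∘ ((ract (dualModule D) ∘ (b ⊗^ idm (A : C))) ⊗^ idm (lmo L)) =
    c ∘ (idm X ⊗^ ((idm (rmo M) ⊗^ lmact L) ∘ assoc (rmo M) A (lmo L))) ∘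
    assoc X (rmo M ⊗ A) (lmo L) ∘ (assoc X (rmo M) A ⊗^ idm (lmo L)).
  rewrite tensmMr compA dualModule_ractE.
  rewrite (reassoc (assoc_nat _ _ _)) tensm1 !compA.
  rewrite (reassoc (esym (tensmC b (lmact L)))) compA bE.
  rewrite tensmMl !compA (reassoc3 (pentagon _ _ _ _)) !compA.
  by rewrite -tensm1 (reassoc (assoc_nat _ _ _)) !compA.
have -> : (c ∘ (idm X ⊗^ balancer M L) = 0) <->
    c ∘ (idm X ⊗^ (ract M ⊗^ idm (lmo L))) =
    c ∘ (idm X ⊗^ ((idm (rmo M) ⊗^ lmact L) ∘ assoc (rmo M) A (lmo L))).
  rewrite /balancer.
  have -> : forall (Y Z : C) (f g : mor Y Z),
      idm X ⊗^ (f - g) = (idm X ⊗^ f) - (idm X ⊗^ g).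
    by move=> Y Z f g; rewrite addrC -(scaleN1r g) tensm_linr scaleN1r addrC.
  rewrite compBr; split=> [/eqP|->]; last by rewrite subrr.
  by rewrite subr_eq0 => /eqP.
split=> [/eqP|] e.
  move: e2; rewrite -e e1 => e2.
  apply: (compm_canr (u := assoc _ _ _) (v := assocV _ _ _)); first exact: assocVK.
  apply: (compm_canr (u := assoc X (rmo M) A ⊗^ idm (lmo L))
                     (v := assocV _ _ _ ⊗^ idm _)) => //.
  by rewrite -tensmMr assocVK tensm1.
by apply/eqP/dual_ext; rewrite e1 e2 e.
Qed.

End Balanced.

(** * The bar presentation of a module by free modules *)

Section ActionMorphism.
Variables (k : fieldType) (C : monoidalCategory k) (A : algebraObject C).

Definition actionMor (M : modCat A) : mor (rmo M ▷ regularModule A) M.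
Proof. by exists (ract M); apply/eqP; rewrite ractA /= compA. Defined.

Definition barMor (M : modCat A) :
  mor ((rmo M ⊗ A) ▷ regularModule A) (rmo M ▷ regularModule A) :=
  (ract M ▷^ idm (regularModule A)) -
  (idm (rmo M) ▷^ amulMor A) ∘ mactAssoc (rmo M) A (regularModule A).

(** In [C] the unit of [A] gives a section [u] of the action, and a map [h] that kills the
    difference equals [h ∘ u ∘ ract M]. As [u] need not be [A]-linear, the cokernel is found in [C]
    and lifted to modules. *)
Lemma barMor_cokernel (D : leftDual (A : C)) (M : modCat A) :
  isCokernel (barMor M) (actionMor M).
Proof.
apply: cokernel_modCat => //.
pose u : mor (rmo M) (rmo M ⊗ A) := (idm (rmo M) ⊗^ aone A) ∘ runitV (rmo M).
have ru : ract M ∘ u = idm (rmo M) by rewrite /u compA ract1 runitVK.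
split=> [|W h].
  by rewrite /= compBr ractA compA subrr.
rewrite /= compBr => /eqP; rewrite subr_eq0 => /eqP hE.
exists (h ∘ u); split; last by move=> v <-; rewrite -compA ru compm1.
(* The unit enters as a new rightmost factor. Then [hE] trades the action on [M] for the
   multiplication of [A], which absorbs the unit. *)
rewrite -compA /u -compA runitV_nat (compA (_ ⊗^ _)) -tensmC !compA hE.
rewrite -tensm1 compA (reassoc (assoc_nat _ _ _)) !compA.
by rewrite -(compA h) -tensmMl amulm1 -(compA h) runit_tens compKm // runitVK.
Qed.

End ActionMorphism.

(** * Compatibility of Hom_A(P, -) with [X ⊗ -] *)

HB.lock Definition ihomTens (k : fieldType) (C : monoidalCategory k)
  (A : algebraObject C) (H : internalHom A) (X : C) (P N : modCat A) :
  mor (X ⊗ H P N) (H P (X ▷ N)) :=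
  icurry H ((idm X ▷^ iev H P N) ∘ mactAssoc X (H P N) P).
Arguments ihomTens {k C A} H X P N.

(** For vector spaces this sends [m ⊗ f] to the map [x ↦ m f(x)]. *)
HB.lock Definition tensToHom (k : fieldType) (C : monoidalCategory k)
  (A : algebraObject C) (H : internalHom A) (P M : modCat A) :
  mor (rmo M ⊗ H P (regularModule A)) (H P M) :=
  imap H (idm P) (actionMor M) ∘ ihomTens H (rmo M) P (regularModule A).
Arguments tensToHom {k C A} H P M.

Section Comparison.
Variables (k : fieldType) (C : monoidalCategory k) (A : algebraObject C).
Variable H : internalHom A.
Implicit Types M N P : modCat A.

Lemma ihom_ext_mmor (X : C) M N (g g' : mor X (H M N)) :
  mmor (iev H M N) ∘ (g ⊗^ idm (rmo M)) = mmor (iev H M N) ∘ (g' ⊗^ idm (rmo M)) ->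
  g = g'.
Proof. by move=> e; apply: (@ihom_ext _ _ _ H); exact: val_inj. Qed.

Lemma imap_mmorE M M' N N' (f : mor M' M) (g : mor N N') :
  mmor (iev H M' N') ∘ (imap H f g ⊗^ idm (rmo M')) =
  mmor g ∘ mmor (iev H M N) ∘ (idm (H M N) ⊗^ mmor f).
Proof. exact: (congr1 (@mmor _ _ _ _ _) (imapE H f g)). Qed.

Lemma ihomTensE (X : C) P N :
  mmor (iev H P (X ▷ N)) ∘ (ihomTens H X P N ⊗^ idm (rmo P)) =
  (idm X ⊗^ mmor (iev H P N)) ∘ assoc X (H P N) (rmo P).
Proof. by rewrite ihomTens.unlock; exact: (congr1 (@mmor _ _ _ _ _) (icurryK H (_ ∘ _))). Qed.

Lemma ihomTens_nat (X X' : C) P N (x : mor X X') :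
  imap H (idm P) (x ▷^ idm N) ∘ ihomTens H X P N =
  ihomTens H X' P N ∘ (x ⊗^ idm (H P N)).
Proof.
move: (imap _ _ _) (imap_mmorE (idm P) (x ▷^ idm N)) => g gE.
apply: ihom_ext_mmor; rewrite !tensmMr !compA gE ihomTensE /= tensm1 compm1.
rewrite (reassoc (ihomTensE _ _ _)) (reassoc (assoc_nat _ _ _)) tensm1 !compA.
by rewrite tensmC.
Qed.

(** As [X] is a right dual of [D], maps from [Z] into [X ⊗ H P N] are maps from [D ⊗ Z] into
    [H P N]. The inverse is therefore given by its transpose, and both composites are checked after
    applying [levT] and [iev]. *)
Lemma ihomTens_iso (X : C) (D : leftDual X) P N : isIso (ihomTens H X P N).
Proof.
pose R : rightDual (D : C) := leftDual_rightDual D.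
have K : mmor (iev H P N) ∘ (levT R (H P N) ⊗^ idm (rmo P)) =
    levT R (rmo N) ∘
    (idm (D : C) ⊗^ (mmor (iev H P (X ▷ N)) ∘ (ihomTens H X P N ⊗^ idm (rmo P)))) ∘
    assoc (D : C) (X ⊗ H P N) (rmo P).
  rewrite ihomTensE levT_tens tensmMl !compA.
  by rewrite -[in LHS]levT_nat.
(* [r0 : D ⊗ H P (X ▷ N) -> H P N] contracts [D] with [X] inside the target module; its transpose
   [r] is the inverse. *)
pose r0 := icurry H (levTm R N ∘ (idm (D : C) ▷^ iev H P (X ▷ N)) ∘
                     mactAssoc (D : C) (H P (X ▷ N)) P).
have r0E : mmor (iev H P N) ∘ (r0 ⊗^ idm (rmo P)) =
    levT R (rmo N) ∘ (idm (D : C) ⊗^ mmor (iev H P (X ▷ N))) ∘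
    assoc (D : C) (H P (X ▷ N)) (rmo P).
  exact: (congr1 (@mmor _ _ _ _ _) (icurryK H (_ ∘ _))).
move: r0 r0E => r0 r0E; pose r : mor _ (X ⊗ _) := ltransp R r0.
have rE : levT R (H P N) ∘ (idm (D : C) ⊗^ r) = r0 by exact: ltranspK.
move: r rE => r rE; exists r; split.
  apply: (ltransp_inj (R := R)); rewrite tensmMl compA rE tensm1 compm1.
  apply: ihom_ext_mmor; rewrite tensmMr compA r0E K.
  rewrite (reassoc (assoc_nat _ _ _)) !compA.
  by rewrite tensmMl !compA.
apply: ihom_ext_mmor; apply: (ltransp_inj (R := R)).
rewrite tensm1 compm1.
apply: (compm_canr (u := assoc (D : C) (H P (X ▷ N)) (rmo P)) (v := assocV _ _ _)).
  exact: assocVK.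
rewrite -r0E -rE !tensmMr [RHS]compA K -(compA (_ ∘ _) (assoc _ _ _)) assoc_nat.
by rewrite !tensmMl !compA.
Qed.

End Comparison.

(** * Hom_A(P, M) as the tensor product of [M] and Hom_A(P, A) over [A] *)

Section TensorToHom.
Variables (k : fieldType) (C : monoidalCategory k) (A : algebraObject C).
Variable H : internalHom A.
Implicit Types M N P : modCat A.

Lemma tensToHomE P M :
  mmor (iev H P M) ∘ (tensToHom H P M ⊗^ idm (rmo P)) =
  ract M ∘ (idm (rmo M) ⊗^ mmor (iev H P (regularModule A))) ∘
    assoc (rmo M) (H P (regularModule A)) (rmo P).
Proof.
rewrite tensToHom.unlock.
move: (imap _ _ _) (imap_mmorE H (idm P) (actionMor M)) => g gE.
by rewrite tensmMr compA gE /= tensm1 compm1 (reassoc (ihomTensE _ _ _ _)) !compA.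
Qed.

Lemma tensToHom_nat P P' M M' (p : mor P P') (m : mor M' M) :
  tensToHom H P M ∘ (mmor m ⊗^ imap H p (idm (regularModule A))) =
  imap H p m ∘ tensToHom H P' M'.
Proof.
move: (imap H p (idm _)) (imap_mmorE H p (idm (regularModule A))) => g gE.
move: (imap _ _ _) (imap_mmorE H p m) => h hE.
apply: ihom_ext_mmor; rewrite !tensmMr !compA tensToHomE hE.
rewrite (reassoc (esym (tensmC (tensToHom H P' M') _))) !compA.
rewrite (reassoc (tensToHomE _ _)) !compA.
rewrite (reassoc (assoc_nat _ _ _)) -[in RHS]tensm1 !compA.
rewrite (reassoc (assoc_nat _ _ _)) !compA; congr (_ ∘ _).
have mE : mmor m ∘ ract M' = ract M ∘ (mmor m ⊗^ idm (A : C)).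
  exact: mmorE (m : moduleMor M' M).
rewrite mE -!(compA (ract M)); congr (_ ∘ _).
by rewrite -!tensmM comp1m gE /= !comp1m !compm1.
Qed.

(** This identifies the balancer with the image of the bar presentation. The terms with the action
    on [M] match by naturality of [ihomTens], the others by the definition of the left action on
    Hom_A(P, A). *)
Lemma ihomTens_balancer P M :
  ihomTens H (rmo M) P (regularModule A) ∘ balancer M (ihomLeft H P) =
  imap H (idm P) (barMor M) ∘ ihomTens H (rmo M ⊗ A) P (regularModule A).
Proof.
have -> : imap H (idm P) (barMor M) =
    imap H (idm P) (ract M ▷^ idm (regularModule A)) -
    imap H (idm P) ((idm (rmo M) ▷^ amulMor A) ∘
                    mactAssoc (rmo M) A (regularModule A)).
  by rewrite /barMor addrC -scaleN1r imap_linr scaleN1r addrC.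
rewrite /balancer compBl compBr -ihomTens_nat; congr (_ - _).
pose g := imap H (idm P) ((idm (rmo M) ▷^ amulMor A) ∘
                    mactAssoc (rmo M) A (regularModule A)).
have := imap_mmorE H (idm P) ((idm (rmo M) ▷^ amulMor A) ∘
                    mactAssoc (rmo M) A (regularModule A)).
rewrite -/g /= tensm1 compm1; move: g => g gE.
move: (ihomAct H P) (ihomActE H P) => a aE.
apply: ihom_ext_mmor; rewrite !tensmMr !compA gE !ihomTensE.
rewrite (reassoc (assoc_nat _ _ _)) compA -tensmMl aE.
rewrite (reassoc (ihomTensE _ _ _ _)) !tensmMl !compA.
rewrite (reassoc3 (pentagon _ _ _ _)) !compA.
by rewrite -tensm1 (reassoc (assoc_nat _ _ _)) !compA.
Qed.

Lemma tensToHom_balancer P M : tensToHom H P M ∘ balancer M (ihomLeft H P) = 0.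
Proof.
rewrite tensToHom.unlock -compA ihomTens_balancer compA -imapM.
suff -> : actionMor M ∘ barMor M = 0.
  by rewrite comp1m -[imap _ _ _]/(fmap (ihomFunctor H P) 0) fmap0 comp0m.
by apply: val_inj; rewrite /= compBr ractA compA subrr.
Qed.

(** C-projectivity enters here: Hom_A(P, -) preserves the bar cokernel, which is then transported
    along the isomorphisms [ihomTens]. *)
Lemma tensToHom_cokernel P M :
  (forall X : C, leftDual X) -> Cprojective H P ->
  isCokernel (balancer M (ihomLeft H P)) (tensToHom H P M).
Proof.
move=> ld [_ hP]; rewrite tensToHom.unlock.
apply: cokernel_iso (ihomTens_balancer P M) _.
- exact: ihomTens_iso.
- exact: ihomTens_iso.
- exact: hP _ _ _ _ _ (barMor_cokernel (ld A) M).
Qed.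

End TensorToHom.

(** * Right exactness of the Serre functor and the natural isomorphism *)

Section RelativeSerre.
Variables (k : fieldType) (C : finiteTensorCategory k) (A : algebraObject C).
Variable H : internalHom A.
Implicit Types M N P : modCat A.

Lemma serreFunctor_rightExact : rightExact (serreFunctor H).
Proof.
move=> X Y Q f p fp; apply: cokernel_modCat (ldual (A : C)) _ _ _ _ _ _.
apply: dual_cokernel (@rdual _ C) _.
exact: ihom_kernel (@rdual _ C) _ _ _ _ _ _ fp.
Qed.

(** The pairing with Hom_A(P, A) passes through [tensToHom], which kills the balancer, so
    [dualModule_linear] applies. *)
Lemma serreCurry_rlinear P M :
  dtransp (ldual (H P (regularModule A)))
    (ev (ldual (H P M)) ∘ (idm _ ⊗^ tensToHom H P M) ∘ assoc _ (rmo M) _)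
  \in @rlinear _ _ A (ldual (H P M) ▷ M) (serreObj H P).
Proof.
apply/(@dualModule_linear _ _ _ _ M (ihomLeft H P)); rewrite /= dtranspK compKm ?assocVK //.
by rewrite -compA -tensmMl tensToHom_balancer -[_ ⊗^ 0]/(fmap (tenslFunctor _) 0) fmap0 compm0.
Qed.

Definition serreCurry P M : mor (ldual (H P M) ▷ M) (serreObj H P) :=
  ModuleMor (serreCurry_rlinear P M).

Definition serreIso P M : mor (ldual (H P M)) (H M (serreObj H P)) :=
  icurry H (serreCurry P M).

Lemma serreCurryE P M :
  ev (ldual (H P (regularModule A))) ∘
    (mmor (serreCurry P M) ⊗^ idm (H P (regularModule A))) =
  ev (ldual (H P M)) ∘ (idm _ ⊗^ tensToHom H P M) ∘ assoc _ (rmo M) _.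
Proof. exact: dtranspK. Qed.

Lemma serreIsoE P M :
  mmor (iev H M (serreObj H P)) ∘ (serreIso P M ⊗^ idm (rmo M)) =
  mmor (serreCurry P M).
Proof. exact: (congr1 (@mmor _ _ _ _ _) (icurryK H (serreCurry P M))). Qed.

(** This is the Yoneda argument made explicit: composition with [phi] is shown injective on maps
    from any [X], and the identity of the target is shown to be in its image. The resulting right
    inverse is two-sided by injectivity. *)
Lemma serreIso_iso P M : Cprojective H P -> isIso (serreIso P M).
Proof.
move=> /(tensToHom_cokernel M (@ldual _ C)) cok.
move: (mmor (serreCurry P M)) (serreCurryE P M) (serreIsoE P M) => b bE.
move: (serreIso P M) => phi phiE.
have cokX X := tensl_rightExact (rdual X) cok.
(* Undoing both adjunctions turns [phi ∘ w] into the pairing given by [w], precomposed with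
   [X ⊗ tensToHom], which is an epimorphism by [cokX]. *)
have phiM X (w : mor X (ldual (H P M))) :
    ev (ldual (H P (regularModule A))) ∘
    ((mmor (iev H M (serreObj H P)) ∘ ((phi ∘ w) ⊗^ idm (rmo M))) ⊗^
       idm (H P (regularModule A))) =
    ev (ldual (H P M)) ∘ (w ⊗^ idm (H P M)) ∘ (idm X ⊗^ tensToHom H P M) ∘
    assoc X (rmo M) (H P (regularModule A)).
  rewrite [(phi ∘ w) ⊗^ _]tensmMr compA phiE tensmMr compA bE.
  by rewrite (reassoc (assoc_nat _ _ _)) tensm1 !compA (reassoc (esym (tensmC w _))) !compA.
have mono X (w w' : mor X (ldual (H P M))) : phi ∘ w = phi ∘ w' -> w = w'.
  move=> e; apply: dual_ext; apply: (cokernel_epi (cokX X)) => /=.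
  apply: (compm_canr (u := assoc X (rmo M) (H P (regularModule A))) (v := assocV _ _ _)).
    exact: assocVK.
  by rewrite -!phiM e.
(* The identity of this [X] corresponds to [iev]. Being [A]-linear, it gives a balanced pairing,
   which factors through [X ⊗ tensToHom]; the transpose of the factor [g] is the inverse. *)
set X := H M (serreObj H P).
have /= := @dualModule_linear _ _ _ X M (ihomLeft H P) (ldual (H P (regularModule A)))
  (iev H M (serreObj H P)).
case=> /(_ (mmorP _)) bal _.
have [g [gE _]] := proj2 (cokX X) _ _ bal.
exists (dtransp (ldual (H P M)) g).
suff phiK : phi ∘ dtransp (ldual (H P M)) g = idm X.
  by split=> //; apply: mono; rewrite compA phiK comp1m compm1.
apply: ihom_ext_mmor; apply: dual_ext; rewrite phiM dtranspK.
move: gE => /= ->; rewrite compKm ?assocK //.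
by rewrite tensm1 compm1.
Qed.

(** Tested against evaluation at [M'] and then against Hom_A(P', A), both sides become pairings with
    the dual of Hom_A(P, M), and they agree by naturality of [tensToHom]. *)
Lemma serreIso_nat P P' M M' (p : mor P P') (m : mor M' M) :
  imap H m (serreMor H p) ∘ serreIso P M =
  serreIso P' M' ∘ dualMor (ldual (H P' M')) (ldual (H P M)) (imap H p m).
Proof.
have Tn := tensToHom_nat H p m.
pose q := imap H p (idm (regularModule A)).
pose L := ldual (H P (regularModule A)); pose L' := ldual (H P' (regularModule A)).
have dE := dualMorE L' L q.
have eE := dualMorE (ldual (H P' M')) (ldual (H P M)) (imap H p m).
have sE : mmor (iev H M' (serreObj H P')) ∘
    (imap H m (serreMor H p) ⊗^ idm (rmo M')) =
    dualMor L' L q ∘ mmor (iev H M (serreObj H P)) ∘ (idm _ ⊗^ mmor m).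
  exact: imap_mmorE.
rewrite -/q in Tn; move: (dualMor L' L q) dE sE (dualMor _ _ _) eE => d dE sE e eE.
have := serreIsoE P' M'; have := serreIsoE P M.
have := serreCurryE P' M'; have := serreCurryE P M; rewrite -/L -/L'.
move: (imap H m (serreMor H p)) (serreIso P M) (serreIso P' M') sE => s phi phi' sE.
move: (mmor (serreCurry P M)) (mmor (serreCurry P' M')) => b b' bE b'E phiE phiE'.
apply: ihom_ext_mmor; apply: (dual_ext (D := L')).
rewrite !(tensmMr (rmo M')) !compA sE.
rewrite -(compA (_ ∘ _)) -tensmC (compA (_ ∘ _)) -(compA d) phiE phiE' /=.
rewrite !tensmMr !compA dE b'E.
rewrite (reassoc (esym (tensmC b q))) compA bE.
rewrite (reassoc (esym (tensm_split (idm _ ⊗^ mmor m) q))).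
rewrite (reassoc (assoc_nat _ (mmor m) q)) (reassoc (assoc_nat e _ _)) tensm1 !compA.
rewrite (reassoc (esym (tensmC e (tensToHom H P' M')))) compA eE.
by rewrite -!(compA (ev _)) -!tensmMl Tn.
Qed.

End RelativeSerre.

Theorem lemma4p8 (k : fieldType) (C : finiteTensorCategory k)
    (A : algebraObject C) (H : internalHom A) :
  isRelativeSerre H (serreFunctor H).
Proof.
split; first exact: serreFunctor_rightExact.
exists (fun P M _ => serreIso H P M); split=> [P M hP|P P' M M' hP hP' p m].
  exact: serreIso_iso.
exact: serreIso_nat.
Qed.
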